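(* There exists an absolute constant $\tau_0\geq 8$ such that for every $\tau\geq\tau_0$ there exists $\theta_0=\theta_0(\tau)\geq1$ such that for every $\theta\geq\theta_0$ the following holds. Let $N\geq2$ be an integer and let $U,V\in\mathrm{Mat}_N$ be hermitian matrices with $\|U\|\vee\|V\|\leq4$. Let $$\mathcal R=\left\{z\in\mathfrak h\ \Big|\ |\Re z|\leq8\ \text{and}\ \tfrac1N\leq\Im z\leq\tau\right\},\qquad K=\sup_{z\in\mathcal R}\mathfrak K(z)<\infty,$$ $$\mathcal X=\left\{z\in\mathcal R\ \Big|\ \frac{4c_*^2\theta^2K^2}{N}\leq h(z)^2\,\Im z\right\}$$ (a closed, possibly empty set). Then $$z\in\mathcal X\ \Longrightarrow\ \max_{1\le i\le N}\|G_i-M\|\leq\frac{\theta K}{\sqrt{N\,h(z)\,\Im z}}.$$ Here $\mathfrak K(z)$, $G_i$, $M$, $h(z)$ (all depending on $z$) and the absolute constant $c_*$ are as defined in the context.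
   Context: Notation. $x\vee y=\max(x,y)$, $x\wedge y=\min(x,y)$, $x_\bullet=x\vee 1$; $\mathfrak h=\{z\in\mathbb C:\Im z>0\}$. $\mathrm{Mat}_{k\times\ell}$ is the space of $k\times\ell$ complex matrices, $\mathrm{Mat}_k=\mathrm{Mat}_{k\times k}$, $I_k$ the identity; $\|A\|$ is the largest singular value of $A$ and $\|A\|_2=(\mathrm{tr}\,AA^* )^{1/2}$. For a linear map $T:\mathrm{Mat}_3\to\mathrm{Mat}_3$, $\|T\|$ is the operator norm with respect to the largest-singular-value norm. $A\otimes B$ is the Kronecker product, whose block in position $(i,j)$ is $A(i,j)B$. Functions of $z\in\mathfrak h$. Let $\mathbf u,\mathbf v$ be freely independent (standard, variance one) semicircular noncommutative random variables, $\mu$ the law of $\mathbf u\mathbf v+\mathbf v\mathbf u$, and $m=m(z)=\int\frac{\mu(dt)}{t-z}$. (Taken for granted by a known result of Nica and Speicher: $zm^3-m^2-zm-1=0$.) Let $\zeta=\sqrt{\frac{11+5\sqrt5}{2}}$ and $h=h(z)=|z+\zeta|\wedge|z-\zeta|\wedge1$. Let $\{e_{ij}\}$ be the standard basis of $\mathrm{Mat}_3$, $\Phi(A)=(e_{12}+e_{21})A(e_{12}+e_{21})+(e_{13}+e_{31})A(e_{13}+e_{31})$ for $A\in\mathrm{Mat}_3$, $\Lambda=\mathrm{diag}(z,-1,1)$, $M=\mathrm{diag}\big(m,-\frac1{m-1},-\frac1{m+1}\big)$. The linear map $x\mapsto M^{-1}x-\Phi(x)M$ of $\mathrm{Mat}_3$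 to itself is invertible; $\kappa$ denotes its inverse. $c_*\geq1$ denotes a fixed absolute constant such that $\frac{1}{8\|\kappa\|_\bullet\|\Phi\|_\bullet}\geq\frac{\sqrt{h(z)}}{c_*}$ for all $z\in\mathfrak h$ (the paper shows such a constant exists). Generalized resolvent. Given an integer $N\ge2$ and hermitian $U,V\in\mathrm{Mat}_N$, let $$X=\begin{bmatrix}0&\frac{U-V}{\sqrt2}&\frac{-U-V}{\sqrt2}\\ \frac{U-V}{\sqrt2}&0&0\\ \frac{-U-V}{\sqrt2}&0&0\end{bmatrix}\in\mathrm{Mat}_{3N}.$$ For $z\in\mathfrak h$ the matrix $X-\Lambda\otimes I_N$ is invertible; let $R=(X-\Lambda\otimes I_N)^{-1}$. Let $e_i\in\mathrm{Mat}_{1\times N}$ be the $i$th row of $I_N$, $\hat e_i\in\mathrm{Mat}_{(N-1)\times N}$ be $I_N$ with the $i$th row deleted, $\mathbf e_i=I_3\otimes e_i$, $\hat{\mathbf e}_i=I_3\otimes\hat e_i$. For $i=1,\dots,N$ let $$G_i=\mathbf e_iR\mathbf e_i^*\in\mathrm{Mat}_3,\quad R_i=(\hat{\mathbf e}_iX\hat{\mathbf e}_i^*-\Lambda\otimes I_{N-1})^{-1}\in\mathrm{Mat}_{3(N-1)},\quad \widehat G_i=\frac1N\sum_{j=1}^N\mathbf e_j\hat{\mathbf e}_i^*R_i\hat{\mathbf e}_i\mathbf e_j^*\in\mathrm{Mat}_3,$$ $$Q_i=\mathbf e_iX\hat{\mathbf e}_i^*R_i\hat{\mathbf e}_iX\mathbf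 e_i^*-\mathbf e_iX\mathbf e_i^*-\Phi(\widehat G_i)\in\mathrm{Mat}_3,$$ $$\mathfrak K_i=1\vee\frac{\|Q_i\|}{\frac1{\sqrt N}\left(1\vee\frac{\|R_i\|_2}{\sqrt N}\right)},\qquad \mathfrak K=\mathfrak K(z)=\max_{1\le i\le N}\mathfrak K_i.$$ All of these depend on $z$. *)

(* Defs.v *)
From HB Require Import structures.
From mathcomp Require Import all_boot all_order all_algebra.
From mathcomp Require Import complex mxtens.
From mathcomp Require Import all_classical all_reals all_analysis.

Set Implicit Arguments.
Unset Strict Implicit.
Unset Printing Implicit Defensive.

Import Order.TTheory GRing.Theory Num.Theory.
Import numFieldNormedType.Exports.

Local Open Scope classical_set_scope.
Local Open Scope ring_scope.
Local Open Scope complex_scope.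
Local Open Scope sesquilinear_scope.

(** * Complex numbers and matrix norms *)

(* The library norm `|z| of z : R[i] is itself an element of R[i]; this is the
   same number as an element of R. *)
Definition cabs {R : realType} (z : R[i]) : R := complex.Re `|z|.

Definition upper_half_plane {R : realType} : set R[i] :=
  [set z | 0 < complex.Im z].

Definition bullet {R : realType} (x : R) : R := Num.max x 1.

(* Singular values are the nonnegative square roots of eigenvalues of A^* A. *)
Definition singular_values {R : realType} {k l : nat} (A : 'M[R[i]]_(k, l)) :
  set R := [set s | 0 <= s /\ eigenvalue (A^t* *m A) ((s ^+ 2)%:C)].

(* The set of singular values is finite, so that the supremum is a maximum. *)
Definition mxnorm {R : realType} {k l : nat} (A : 'M[R[i]]_(k, l)) : R :=
  sup (singular_values A).

Definition mxnorm2 {R : realType} {k l : nat} (A : 'M[R[i]]_(k, l)) : R :=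
  Num.sqrt (complex.Re (\tr (A *m A^t*))).

Definition opnorm {R : realType} (T : 'M[R[i]]_3 -> 'M[R[i]]_3) : R :=
  sup [set mxnorm (T A) | A in [set A | mxnorm A <= 1]].

(** * Free semicircular variables

   As usual, a noncommutative probability space is a unital complex algebra A
   with a linear functional phi such that phi 1 = 1. *)

Section NoncommutativeProbability.
Context {R : realType} {A : algType R[i]}.
Implicit Types (phi : A -> R[i]) (a u v : A).

(* The letter (true, p) stands for p(u), and (false, p) for p(v). *)
Definition letter u v (x : bool * {poly R[i]}) : A :=
  horner_alg (if x.1 then u else v) x.2.

(* Freeness of the unital subalgebras generated by u and by v: alternating
   products of centered elements are centered. *)
Definition freely_independent phi u v : Prop :=
  forall s : seq (bool * {poly R[i]}),
    (0 < size s)%N ->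
    sorted (fun x y => x.1 != y.1) s ->
    (forall x, x \in s -> phi (letter u v x) = 0) ->
    phi (\prod_(x <- s) letter u v x) = 0.

(* The law of u is the semicircle law sqrt(4 - x^2) / (2 pi) on [-2, 2]. *)
Definition standard_semicircular phi u : Prop :=
  forall k : nat, phi (u ^+ k) =
    (\int[lebesgue_measure]_(x in `[-2, 2]%classic)
       (x ^+ k * Num.sqrt (4 - x ^+ 2) / (2 * pi)) : R)%:C.

Definition is_law phi a (mu : probability (measurableTypeR R) R) : Prop :=
  (exists B : R, mu `[- B, B]%classic = 1%E) /\
  (forall k : nat, phi (a ^+ k) = (\int[mu]_t t ^+ k : R)%:C).

End NoncommutativeProbability.

(** * Functions on the upper half-plane *)

Section HalfPlane.
Context {R : realType} (mu : probability (measurableTypeR R) R).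
Implicit Types z : R[i].

Definition stieltjes z : R[i] :=
  (\int[mu]_t complex.Re ((t%:C - z)^-1) : R)
    +i* (\int[mu]_t complex.Im ((t%:C - z)^-1) : R).

Definition zeta : R := Num.sqrt ((11 + 5 * Num.sqrt 5) / 2).

Definition hfun z : R :=
  Num.min (Num.min (cabs (z + zeta%:C)) (cabs (z - zeta%:C))) 1.

Definition e12 : 'M[R[i]]_3 := delta_mx 0 1.
Definition e21 : 'M[R[i]]_3 := delta_mx 1 0.
Definition e13 : 'M[R[i]]_3 := delta_mx 0 2.
Definition e31 : 'M[R[i]]_3 := delta_mx 2 0.

Definition Phi (A : 'M[R[i]]_3) : 'M[R[i]]_3 :=
  (e12 + e21) *m A *m (e12 + e21) + (e13 + e31) *m A *m (e13 + e31).

Definition diag3 (a b c : R[i]) : 'M[R[i]]_3 :=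
  diag_mx (\row_(j < 3) nth 0 [:: a; b; c] j).

Definition Lambda z : 'M[R[i]]_3 := diag3 z (-1) 1.

Definition Mmx z : 'M[R[i]]_3 :=
  let m := stieltjes z in diag3 m (- (m - 1)^-1) (- (m + 1)^-1).

(* inv_lfun (a pseudo-inverse in general) is the inverse of an invertible map,
   which this one is for z in the upper half-plane. *)
Definition kappa z : 'End('M[R[i]]_3) :=
  ((linfun (fun x : 'M[R[i]]_3 => invmx (Mmx z) *m x - Phi x *m Mmx z))^-1)%VF.

End HalfPlane.

(** * Generalized resolvent *)

Section Resolvent.
Context {R : realType} {N : nat} (U V : 'M[R[i]]_N).
Implicit Types (z : R[i]) (i : 'I_N).

Definition sqrt2 : R[i] := (Num.sqrt (2 : R))%:C.

(* e_ij *t B is the 3 x 3 block matrix whose only nonzero block is B, in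
   position (i, j). *)
Definition Xmx : 'M[R[i]]_(3 * N) :=
  (e12 + e21) *t (sqrt2^-1 *: (U - V)) + (e13 + e31) *t (sqrt2^-1 *: (- U - V)).

Definition Rmx z : 'M[R[i]]_(3 * N) := invmx (Xmx - Lambda z *t 1%:M).

Definition bfe i : 'M[R[i]]_(3 * 1, 3 * N) := 1%:M *t row i 1%:M.

Definition bfehat i : 'M[R[i]]_(3 * N.-1, 3 * N) := 1%:M *t row' i 1%:M.

(* The type 'M_(3 * 1) is convertible to 'M_3. *)
Definition Gmx z i : 'M[R[i]]_3 := bfe i *m Rmx z *m (bfe i)^t*.

Definition Rimx z i : 'M[R[i]]_(3 * N.-1) :=
  invmx (bfehat i *m Xmx *m (bfehat i)^t* - Lambda z *t 1%:M).

Definition Ghat z i : 'M[R[i]]_3 :=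
  N%:R^-1 *: \sum_(j < N)
    (bfe j *m (bfehat i)^t* *m Rimx z i *m bfehat i *m (bfe j)^t*).

Definition Qmx z i : 'M[R[i]]_3 :=
  bfe i *m Xmx *m (bfehat i)^t* *m Rimx z i
    *m bfehat i *m Xmx *m (bfe i)^t*
  - bfe i *m Xmx *m (bfe i)^t* - Phi (Ghat z i).

Definition frakKi z i : R :=
  Num.max 1 (mxnorm (Qmx z i) /
    ((Num.sqrt N%:R)^-1 *
     Num.max 1 (mxnorm2 (Rimx z i) / Num.sqrt N%:R))).

(* Every frakKi z i is at least 1, so that 1 is a neutral initial value. *)
Definition frakK z : R := \big[Num.max/1]_(i < N) frakKi z i.

Definition calR (tau : R) : set R[i] :=
  [set z | [/\ upper_half_plane z, `|complex.Re z| <= 8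
             & N%:R^-1 <= complex.Im z <= tau]].

Definition supK (tau : R) : R := sup [set frakK z | z in calR tau].

Definition calX (cstar tau theta : R) : set R[i] :=
  [set z | calR tau z /\
    4 * cstar ^+ 2 * theta ^+ 2 * supK tau ^+ 2 / N%:R
      <= hfun z ^+ 2 * complex.Im z].

End Resolvent.

(* Main.v *)
Require Import Defs.
From HB Require Import structures.
From mathcomp Require Import all_boot all_order all_algebra.
From mathcomp Require Import complex mxtens.
From mathcomp Require Import all_classical all_reals all_analysis.
From mathcomp Require Import ring lra.

(** The matrices G_i satisfy (Lambda + Phi (Ghat_i) + Q_i) G_i = -1, a perturbation
    of the equation (Lambda + Phi M) M = -1. The proof is a continuity argument in
    Im z that exploits the stability of the latter.

    Errors. By the Schur complement formula [self_consistency] the perturbation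
    with respect to the average F of the G_i is E_i = Q_i + Phi (Ghat_i - F). The
    matrices Ghat_i and F are normalized partial traces of R_i and R, which differ
    by a matrix of rank at most 3 [elimination_diff] and of norm O(1 / Im z)
    [resolvent_le]; so Ghat_i - F is O(1 / (N Im z)) [Ghat_sub_Gavg], without any
    bound on the inverse of G_i. The matrix Q_i is controlled by K and by the
    Frobenius norm of R_i. Only the first block row of the equation defining R_i
    involves z. The first block row of R_i is controlled by the imaginary part of
    the trace of R_i, that is by Ghat_i, and the equation expresses the other two
    through it [resolvent_mxnorm2_le]. Altogether E_i is
    O(K / sqrt (N Im z)) as long as F stays bounded [error_le].

    Stability. The equation linearizes at M into an injective map of the 3 x 3
    matrices with inverse kappa [kappaK]. Injectivity rests on the location of m:
    the cubic equation and Im z > 0 force Im m > 0 and |m| < 1 [cubic_half_disc].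
    When all the G_i are within sqrt h / cstar of M, the quadratic term is absorbed
    [stability], and one gets |G_i - M| = O(K / sqrt (N h Im z))
    [self_improvement]. Inside calX, for theta large, this is at most half of
    sqrt h / cstar [calX_scale].

    Descent. At height tau both G_i and M are O(1 / sqrt tau) away from
    diag (0, 1, -1) [Gmx_top], so the a priori bound holds there once tau is large.
    The part of calX on a vertical line extends up to height tau, and along it the
    deviation of the G_i from M is continuous and never takes a value between half
    the admissible one and the admissible one; hence the a priori bound propagates
    down to every point of calX [descent], where it improves to the claim. *)

Set Implicit Arguments.
Unset Strict Implicit.
Unset Printing Implicit Defensive.

Import Order.TTheory GRing.Theory Num.Theory.
Import numFieldNormedType.Exports.

Local Open Scope classical_set_scope.
Local Open Scope ring_scope.
Local Open Scope complex_scope.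
Local Open Scope sesquilinear_scope.

(** * Moduli of complex numbers *)

Section Modulus.
Context {R : realType}.
Implicit Types (z w : R[i]) (x y : R).

Lemma le_of_sqr x y : 0 <= y -> x ^+ 2 <= y ^+ 2 -> x <= y.
Proof. by move=> y0 h; rewrite leNgt; apply/negP => xy; nra. Qed.

Lemma cabsE z : cabs z = Num.sqrt (complex.Re z ^+ 2 + complex.Im z ^+ 2).
Proof. by rewrite /cabs normc_def. Qed.

Lemma cabs_norm z : (cabs z)%:C = `|z|.
Proof. by rewrite cabsE normc_def. Qed.

Lemma cabs_ge0 z : 0 <= cabs z. Proof. by rewrite cabsE sqrtr_ge0. Qed.

Lemma sqr_cabs z : cabs z ^+ 2 = complex.Re z ^+ 2 + complex.Im z ^+ 2.
Proof. by rewrite cabsE sqr_sqrtr// addr_ge0// sqr_ge0. Qed.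

Lemma cabsM z w : cabs (z * w) = cabs z * cabs w.
Proof. by apply: complexI; rewrite rmorphM/= !cabs_norm normrM. Qed.

Lemma cabsN z : cabs (- z) = cabs z.
Proof. by rewrite /cabs normrN. Qed.

Lemma cabs0 : cabs (0 : R[i]) = 0. Proof. by rewrite /cabs normr0. Qed.

Lemma cabs1 : cabs (1 : R[i]) = 1. Proof. by rewrite /cabs normr1. Qed.

Lemma cabsV z : cabs z^-1 = (cabs z)^-1.
Proof. by apply: complexI; rewrite fmorphV/= !cabs_norm normfV. Qed.

Lemma cabsD z w : cabs (z + w) <= cabs z + cabs w.
Proof. by rewrite -lecR rmorphD/= !cabs_norm ler_normD. Qed.

Lemma cabsB z w : cabs (z - w) <= cabs z + cabs w.
Proof. by rewrite (le_trans (cabsD _ _))// cabsN. Qed.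

Lemma cabs_distC z w : cabs (z - w) = cabs (w - z).
Proof. by rewrite -cabsN opprB. Qed.

Lemma cabs_sum I (r : seq I) (P : pred I) (F : I -> R[i]) :
  cabs (\sum_(i <- r | P i) F i) <= \sum_(i <- r | P i) cabs (F i).
Proof.
elim/big_rec2: _ => [|i y1 y2 _ h]; first by rewrite cabs0.
by rewrite (le_trans (cabsD _ _))// lerD2l.
Qed.

Lemma cabs_real x : cabs x%:C = `|x|.
Proof. by rewrite cabsE/= expr0n addr0 sqrtr_sqr. Qed.

Lemma cabs_eq0 z : (cabs z == 0) = (z == 0).
Proof. by rewrite -[RHS]normr_eq0 -cabs_norm eq_complex/= eqxx andbT. Qed.

Lemma cabs_gt0 z : (0 < cabs z) = (z != 0).
Proof. by rewrite lt0r cabs_ge0 cabs_eq0 andbT. Qed.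

Lemma Re_le_cabs z : `|complex.Re z| <= cabs z.
Proof.
rewrite -(ler_pXn2r (n := 2))// ?nnegrE ?cabs_ge0//.
by rewrite sqr_cabs real_normK ?num_real// lerDl sqr_ge0.
Qed.

Lemma Im_le_cabs z : `|complex.Im z| <= cabs z.
Proof.
rewrite -(ler_pXn2r (n := 2))// ?nnegrE ?cabs_ge0//.
by rewrite sqr_cabs real_normK ?num_real// lerDr sqr_ge0.
Qed.

Lemma cabs_le_ReIm z : cabs z <= `|complex.Re z| + `|complex.Im z|.
Proof.
rewrite -(ler_pXn2r (n := 2))// ?nnegrE ?cabs_ge0 ?addr_ge0//.
rewrite sqr_cabs sqrrD !real_normK ?num_real// lerD2r lerDl.
by rewrite mulrn_wge0// mulr_ge0.
Qed.

Lemma cRe_sum I (r : seq I) (P : pred I) (F : I -> R[i]) :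
  complex.Re (\sum_(i <- r | P i) F i) = \sum_(i <- r | P i) complex.Re (F i).
Proof. exact: (raddf_sum (@complex.Re R : Rcomplex R -> R)). Qed.

Lemma cIm_sum I (r : seq I) (P : pred I) (F : I -> R[i]) :
  complex.Im (\sum_(i <- r | P i) F i) = \sum_(i <- r | P i) complex.Im (F i).
Proof. exact: (raddf_sum (@complex.Im R : Rcomplex R -> R)). Qed.

Lemma cReD z w : complex.Re (z + w) = complex.Re z + complex.Re w.
Proof. by case: z w => [? ?] [? ?]. Qed.
Lemma cImD z w : complex.Im (z + w) = complex.Im z + complex.Im w.
Proof. by case: z w => [? ?] [? ?]. Qed.
Lemma cReN z : complex.Re (- z) = - complex.Re z. Proof. by case: z. Qed.
Lemma cImN z : complex.Im (- z) = - complex.Im z. Proof. by case: z. Qed.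
Lemma cReM z w : complex.Re (z * w) =
  complex.Re z * complex.Re w - complex.Im z * complex.Im w.
Proof. by case: z w => [? ?] [? ?]. Qed.
Lemma cImM z w : complex.Im (z * w) =
  complex.Re z * complex.Im w + complex.Im z * complex.Re w.
Proof. by case: z w => [? ?] [? ?]; rewrite /=; ring. Qed.
Lemma mulJC z : z * z^* = (cabs z ^+ 2)%:C.
Proof. by rewrite rmorphXn/= cabs_norm normCK. Qed.
Lemma cabsJ z : cabs z^* = cabs z.
Proof. by rewrite /cabs norm_conjC. Qed.
End Modulus.
#[global] Hint Extern 0 (is_true (@Order.le _ _ (@Algebra.zero _) (cabs _))) =>
  solve [exact: cabs_ge0] : core.

(** * Euclidean and Frobenius norms *)

Section FrobeniusNorm.
Context {R : realType}.
Implicit Types (k l n p q : nat).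

Lemma real_cauchy_schwarz (I : finType) (a b : I -> R) :
  (\sum_i a i * b i) ^+ 2 <= (\sum_i a i ^+ 2) * (\sum_i b i ^+ 2).
Proof.
have h : 0 <= \sum_i \sum_j (a i * b j - a j * b i) ^+ 2.
  by apply: sumr_ge0 => i _; apply: sumr_ge0 => j _; exact: sqr_ge0.
have e : \sum_i \sum_j (a i * b j - a j * b i) ^+ 2 =
   ((\sum_i a i ^+ 2) * (\sum_i b i ^+ 2) - (\sum_i a i * b i) ^+ 2) *+ 2.
  have -> : \sum_i \sum_j (a i * b j - a j * b i) ^+ 2 =
    \sum_i \sum_j (a i ^+ 2 * b j ^+ 2) + \sum_i \sum_j (b i ^+ 2 * a j ^+ 2)
    - (\sum_i \sum_j ((a i * b i) * (a j * b j))) *+ 2.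
    rewrite -big_split/= -sumrMnl -sumrB; apply: eq_bigr => i _.
    rewrite -big_split/= -sumrMnl -sumrB; apply: eq_bigr => j _; ring.
  have sep (f g : I -> R) : \sum_i \sum_j f i * g j = (\sum_i f i) * \sum_i g i.
    by rewrite mulr_suml; apply: eq_bigr => i _; rewrite mulr_sumr.
  rewrite !sep; ring.
by move: h; rewrite e pmulrn_lge0// subr_ge0.
Qed.

Lemma adjmxE k l (A : 'M[R[i]]_(k, l)) i j : A^t* i j = (A j i)^*.
Proof. by rewrite !mxE. Qed.

Lemma adjmxK k l (A : 'M[R[i]]_(k, l)) : (A^t*)^t* = A.
Proof. exact: trmxCK. Qed.

Lemma adjmxM k l n (A : 'M[R[i]]_(k, l)) (B : 'M[R[i]]_(l, n)) :
  (A *m B)^t* = B^t* *m A^t*.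
Proof. by rewrite trmx_mul map_mxM. Qed.

Lemma adjmxD k l (A B : 'M[R[i]]_(k, l)) : (A + B)^t* = A^t* + B^t*.
Proof. by rewrite raddfD/= map_mxD. Qed.

Lemma adjmxN k l (A : 'M[R[i]]_(k, l)) : (- A)^t* = - A^t*.
Proof. by rewrite raddfN/= map_mxN. Qed.

Lemma adjmxZ k l (a : R[i]) (A : 'M[R[i]]_(k, l)) : (a *: A)^t* = a^* *: A^t*.
Proof. by rewrite linearZ/= map_mxZ. Qed.

Lemma mulmx_scale_mid k l n p (a : R[i]) (A : 'M[R[i]]_(k, l)) (B : 'M[R[i]]_(l, n))
    (C : 'M[R[i]]_(n, p)) : A *m (a *: B) *m C = a *: (A *m B *m C).
Proof. by rewrite -(scalemxAr a A B) -(scalemxAl a (A *m B) C). Qed.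

Lemma adjmx_scalar n (a : R[i]) : (a%:M : 'M[R[i]]_n)^t* = (a^*)%:M.
Proof. by rewrite tr_scalar_mx map_scalar_mx. Qed.

Lemma adjmx1 n : (1%:M : 'M[R[i]]_n)^t* = 1%:M.
Proof. by rewrite adjmx_scalar rmorph1. Qed.

Lemma sqr_mxnorm2 k l (A : 'M[R[i]]_(k, l)) :
  mxnorm2 A ^+ 2 = \sum_i \sum_j cabs (A i j) ^+ 2.
Proof.
have e : complex.Re (\tr (A *m A^t*)) = \sum_i \sum_j cabs (A i j) ^+ 2.
  rewrite cRe_sum; apply: eq_bigr => i _; rewrite mxE cRe_sum.
  by apply: eq_bigr => j _; rewrite adjmxE mulJC.
rewrite /mxnorm2 sqr_sqrtr e//.
by apply: sumr_ge0 => i _; apply: sumr_ge0 => j _; exact: sqr_ge0.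
Qed.

Lemma mxnorm2_ge0 k l (A : 'M[R[i]]_(k, l)) : 0 <= mxnorm2 A.
Proof. exact: sqrtr_ge0. Qed.
#[local] Hint Resolve mxnorm2_ge0 : core.

Lemma sqr_mxnorm2_col n (w : 'cV[R[i]]_n) :
  mxnorm2 w ^+ 2 = \sum_i cabs (w i 0) ^+ 2.
Proof. by rewrite sqr_mxnorm2; apply: eq_bigr => i _; rewrite big_ord1. Qed.

Lemma mxnorm2_dot n (w : 'cV[R[i]]_n) : (w^t* *m w) 0 0 = (mxnorm2 w ^+ 2)%:C.
Proof.
rewrite sqr_mxnorm2_col mxE rmorph_sum/=; apply: eq_bigr => i _.
by rewrite adjmxE mulrC mulJC rmorphXn.
Qed.

Lemma le_mxnorm2 k l p q (A : 'M[R[i]]_(k, l)) (B : 'M[R[i]]_(p, q)) :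
  (mxnorm2 A <= mxnorm2 B) = (mxnorm2 A ^+ 2 <= mxnorm2 B ^+ 2).
Proof. by rewrite ler_pXn2r// nnegrE. Qed.

Lemma mxnorm20 k l : mxnorm2 (0 : 'M[R[i]]_(k, l)) = 0.
Proof. by rewrite /mxnorm2 mul0mx mxtrace0 sqrtr0. Qed.

Lemma mxnorm2_eq0 k l (A : 'M[R[i]]_(k, l)) : (mxnorm2 A == 0) = (A == 0).
Proof.
apply/idP/eqP => [/eqP h|->]; last by rewrite mxnorm20.
apply/matrixP => i j; rewrite mxE; apply/eqP; rewrite -cabs_eq0.
have : mxnorm2 A ^+ 2 = 0 by rewrite h expr0n.
rewrite sqr_mxnorm2 => /psumr_eq0P h1.
have /psumr_eq0P h2 := h1 (fun i _ => sumr_ge0 _ (fun j _ => sqr_ge0 _)) i isT.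
by have /eqP := h2 (fun j _ => sqr_ge0 _) j isT; rewrite sqrf_eq0.
Qed.

Lemma mxnorm2N k l (A : 'M[R[i]]_(k, l)) : mxnorm2 (- A) = mxnorm2 A.
Proof. by rewrite /mxnorm2 adjmxN mulmxN mulNmx opprK. Qed.

Lemma mxnorm2Z k l a (A : 'M[R[i]]_(k, l)) : mxnorm2 (a *: A) = cabs a * mxnorm2 A.
Proof.
apply/eqP; rewrite -(eqrXn2 (n := 2))// ?mulr_ge0 ?cabs_ge0//; apply/eqP.
rewrite exprMn !sqr_mxnorm2 mulr_sumr; apply: eq_bigr => i _.
by rewrite mulr_sumr; apply: eq_bigr => j _; rewrite mxE cabsM exprMn.
Qed.

Lemma cauchy_schwarz_col n (v w : 'cV[R[i]]_n) :
  cabs ((v^t* *m w) 0 0) <= mxnorm2 v * mxnorm2 w.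
Proof.
rewrite mxE (le_trans (cabs_sum _ _ _))//.
rewrite (eq_bigr (fun i => cabs (v i 0) * cabs (w i 0))); last first.
  by move=> i _; rewrite adjmxE cabsM cabsJ.
rewrite -(ler_pXn2r (n := 2))// ?nnegrE ?mulr_ge0//.
  by rewrite exprMn !sqr_mxnorm2_col real_cauchy_schwarz.
by apply: sumr_ge0 => i _; rewrite mulr_ge0 ?cabs_ge0.
Qed.

Lemma mxnorm2D_col n (v w : 'cV[R[i]]_n) :
  mxnorm2 (v + w) <= mxnorm2 v + mxnorm2 w.
Proof.
have cs : \sum_i cabs (v i 0) * cabs (w i 0) <= mxnorm2 v * mxnorm2 w.
  apply: le_of_sqr; first exact: mulr_ge0.
  by rewrite exprMn !sqr_mxnorm2_col; exact: real_cauchy_schwarz.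
have tri : mxnorm2 (v + w) ^+ 2 <=
    \sum_i (cabs (v i 0) ^+ 2 + cabs (v i 0) * cabs (w i 0) *+ 2 + cabs (w i 0) ^+ 2).
  rewrite sqr_mxnorm2_col; apply: ler_sum => i _.
  by rewrite -sqrrD mxE ler_pXn2r ?nnegrE ?addr_ge0 ?cabs_ge0 ?cabsD.
apply: le_of_sqr; first exact: addr_ge0.
apply: le_trans tri _; rewrite !big_split/= sqrrD (sqr_mxnorm2_col v) (sqr_mxnorm2_col w).
by rewrite lerD2r lerD2l mulr2n lerD.
Qed.

Lemma mxnorm2B_col n (v w : 'cV[R[i]]_n) :
  mxnorm2 (v - w) <= mxnorm2 v + mxnorm2 w.
Proof. by rewrite -[mxnorm2 w]mxnorm2N; exact: mxnorm2D_col. Qed.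

Lemma sqr_mxnorm2_cols k l (A : 'M[R[i]]_(k, l)) :
  mxnorm2 A ^+ 2 = \sum_j mxnorm2 (col j A) ^+ 2.
Proof.
rewrite sqr_mxnorm2 exchange_big; apply: eq_bigr => j _.
by rewrite sqr_mxnorm2_col; apply: eq_bigr => i _; rewrite mxE.
Qed.

Lemma cabs_le_mxnorm2 k l (A : 'M[R[i]]_(k, l)) i j : cabs (A i j) <= mxnorm2 A.
Proof.
rewrite -(ler_pXn2r (n := 2))// ?nnegrE ?cabs_ge0// sqr_mxnorm2.
rewrite (bigD1 i)//= (bigD1 j)//= -addrA lerDl addr_ge0// sumr_ge0// => *.
  by rewrite sqr_ge0.
by apply: sumr_ge0 => *; rewrite sqr_ge0.
Qed.

Lemma mxnorm2_delta n (i : 'I_n) : mxnorm2 (delta_mx i 0 : 'cV[R[i]]_n) = 1.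
Proof.
apply/eqP; rewrite -(eqrXn2 (n := 2))// sqr_mxnorm2_col; apply/eqP.
rewrite (bigD1 i)//= !mxE !eqxx cabs1 expr1n big1 ?addr0// => j ji.
by rewrite mxE (negPf ji) cabs0 expr0n.
Qed.

Lemma mxnorm2_mulmx_col k l (A : 'M[R[i]]_(k, l)) (w : 'cV[R[i]]_l) :
  mxnorm2 (A *m w) <= mxnorm2 A * mxnorm2 w.
Proof.
rewrite -(ler_pXn2r (n := 2))// ?nnegrE ?mulr_ge0//.
rewrite exprMn sqr_mxnorm2_col sqr_mxnorm2 mulr_suml; apply: ler_sum => i _.
rewrite sqr_mxnorm2_col mxE; apply: le_trans (real_cauchy_schwarz _ _).
rewrite ler_pXn2r// ?nnegrE ?cabs_ge0 ?sumr_ge0// => [|j _]; last first.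
  by rewrite mulr_ge0 ?cabs_ge0.
by rewrite (le_trans (cabs_sum _ _ _))// ler_sum// => j _; rewrite cabsM.
Qed.

End FrobeniusNorm.
#[global] Hint Extern 0 (is_true (@Order.le _ _ (@Algebra.zero _) (mxnorm2 _))) =>
  solve [exact: mxnorm2_ge0] : core.

(** * Singular values and operator norms *)

Section OperatorNorm.
Context {R : realType}.
Implicit Types (k l n p q : nat).

Lemma sqr_mxnorm2_Re n (w : 'cV[R[i]]_n) :
  mxnorm2 w ^+ 2 = complex.Re ((w^t* *m w) 0 0).
Proof. by rewrite mxnorm2_dot. Qed.

(** If v (A^* A) = s^2 v, then A stretches v^* by exactly s. *)
Lemma singular_values_le k l (A : 'M[R[i]]_(k, l)) (c : R) :
  (forall w : 'cV[R[i]]_l, mxnorm2 (A *m w) <= c * mxnorm2 w) ->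
  ubound (singular_values A) c.
Proof.
move=> hA s [s0 /eigenvalueP[v hv v0]].
have w0 : 0 < mxnorm2 (v^t*).
  rewrite lt0r mxnorm2_ge0 mxnorm2_eq0 andbT; apply: contra v0 => /eqP h.
  by rewrite -[v]adjmxK h trmx0 map_mx0.
have e : mxnorm2 (A *m v^t*) ^+ 2 = s ^+ 2 * mxnorm2 (v^t*) ^+ 2.
  rewrite !sqr_mxnorm2_Re adjmxM adjmxK -!mulmxA.
  have -> : v *m (A^t* *m (A *m v^t*)) = ((s ^+ 2)%:C *: v) *m v^t*.
    by rewrite -hv !mulmxA.
  by rewrite -scalemxAl mxE cReM mul0r subr0.
have c0 : 0 <= c by rewrite -(pmulr_lge0 _ w0); apply: le_trans (mxnorm2_ge0 _) (hA _).
have nA := mxnorm2_ge0 (A *m v^t*); have nv := mxnorm2_ge0 (v^t*).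
rewrite -(ler_pM2r w0) -(ler_pXn2r (n := 2))// ?nnegrE ?mulr_ge0//.
rewrite exprMn -e ler_pXn2r ?nnegrE ?mulr_ge0//; exact: hA.
Qed.

Lemma mxnorm_ge0 k l (A : 'M[R[i]]_(k, l)) : 0 <= mxnorm A.
Proof.
rewrite /mxnorm.
have [->|/set0P[s ss]] := eqVneq (singular_values A) set0; first by rewrite sup0.
have ub := singular_values_le (mxnorm2_mulmx_col A).
apply: (@le_trans _ _ s); first by case: ss.
by apply: ub_le_sup => //; exists (mxnorm2 A).
Qed.
#[local] Hint Extern 0 (is_true (@Order.le _ _ (@Algebra.zero _) (mxnorm _))) =>
  solve [exact: mxnorm_ge0] : core.

Lemma mxnorm_le k l (A : 'M[R[i]]_(k, l)) (c : R) : 0 <= c ->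
  (forall w : 'cV[R[i]]_l, mxnorm2 (A *m w) <= c * mxnorm2 w) -> mxnorm A <= c.
Proof.
move=> c0 /singular_values_le ub; rewrite /mxnorm.
have [->|/set0P ne] := eqVneq (singular_values A) set0; first by rewrite sup0.
exact: ge_sup.
Qed.

(** The spectral theorem for the Hermitian matrix A^* A identifies the largest
    singular value of A with the norm of A as an operator. *)
Lemma mxnormP k l (A : 'M[R[i]]_(k, l)) (w : 'cV[R[i]]_l) :
  mxnorm2 (A *m w) <= mxnorm A * mxnorm2 w.
Proof.
set B := A^t* *m A; set P := spectralmx B; set d := spectral_diag B.
have hB : B = invmx P *m diag_mx d *m P.
  apply/orthomx_spectralP/normalmxP; rewrite /B.
  by rewrite adjmxM adjmxK.
have uP : P \is unitarymx := spectral_unitarymx B.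
have PP : P *m P^t* = 1%:M by apply/unitarymxP.
have PP' : P^t* *m P = 1%:M by rewrite -invmx_unitary// mulVmx ?spectral_unit.
rewrite invmx_unitary// in hB.
have PB : P *m B = diag_mx d *m P by rewrite hB !mulmxA PP mul1mx.
have isom (v : 'cV[R[i]]_l) : mxnorm2 (P *m v) ^+ 2 = mxnorm2 v ^+ 2.
  rewrite !sqr_mxnorm2_Re adjmxM -!mulmxA.
  by rewrite (mulmxA _ P v) PP' mul1mx.
have hd (j : 'I_l) : exists2 s : R, singular_values A s & d 0 j = (s ^+ 2)%:C.
  have e : d 0 j = (mxnorm2 (A *m (row j P)^t*) ^+ 2)%:C.
    rewrite -mxnorm2_dot adjmxM adjmxK -!mulmxA (mulmxA _ A) -/B.
    have -> : (row j P *m (B *m (row j P)^t*)) = row j (P *m B) *m (row j P)^t*.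
      by rewrite row_mul mulmxA.
    have -> : (row j (P *m B) *m (row j P)^t*) 0 0 = (P *m B *m P^t*) j j.
      by rewrite !mxE; apply: eq_bigr => a _; rewrite !mxE.
    by rewrite PB -mulmxA PP mulmx1 mxE eqxx.
  exists (mxnorm2 (A *m (row j P)^t*)) => //; split; first exact: mxnorm2_ge0.
  apply/eigenvalueP; exists (row j P); last first.
    apply/eqP => h; have := congr1 (fun M : 'M[R[i]]_l => M j j) PP.
    rewrite !mxE eqxx big1 => [/esym/eqP|a _]; first by rewrite oner_eq0.
    by have := congr1 (fun M : 'rV[R[i]]_l => M 0 a) h; rewrite !mxE => ->; rewrite mul0r.
  rewrite -e -row_mul -/B PB mul_diag_mx.
  by apply/rowP => a; rewrite !mxE.
have ub := singular_values_le (mxnorm2_mulmx_col A).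
have hA : mxnorm2 (A *m w) ^+ 2 <= mxnorm A ^+ 2 * mxnorm2 w ^+ 2.
  rewrite -(isom w) [X in X <= _]sqr_mxnorm2_Re adjmxM -!mulmxA (mulmxA _ A w) -/B hB.
  rewrite -!mulmxA (mulmxA (w^t*)) -adjmxM mul_diag_mx mxE cRe_sum.
  rewrite sqr_mxnorm2_col mulr_sumr; apply: ler_sum => j _.
  rewrite adjmxE; set v := P *m w; rewrite [X in _ * X]mxE.
  rewrite mulrCA (mulrC (v j 0)^*) mulJC.
  have [s ss ->] := hd j; have s0 : 0 <= s by case: ss.
  have sA : s <= mxnorm A by apply: ub_le_sup => //; exists (mxnorm2 A).
  rewrite -rmorphM/= ler_wpM2r ?sqr_ge0// ler_pXn2r// ?nnegrE ?mxnorm_ge0//.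
by apply: le_of_sqr; [exact: mulr_ge0|rewrite exprMn].
Qed.

#[local] Opaque mxnorm mxnorm2.

Lemma mxnorm2_mulmx_le k l (A : 'M[R[i]]_(k, l)) (w : 'cV[R[i]]_l) (c : R) :
  mxnorm A <= c -> mxnorm2 (A *m w) <= c * mxnorm2 w.
Proof. by move=> h; rewrite (le_trans (mxnormP _ _))// ler_wpM2r. Qed.

Lemma mxnormM k l n (A : 'M[R[i]]_(k, l)) (B : 'M[R[i]]_(l, n)) :
  mxnorm (A *m B) <= mxnorm A * mxnorm B.
Proof.
apply: mxnorm_le => [|w]; first exact: mulr_ge0.
rewrite -mulmxA (le_trans (mxnormP _ _))// -mulrA ler_wpM2l//.
exact: mxnormP.
Qed.

Lemma mxnormD k l (A B : 'M[R[i]]_(k, l)) :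
  mxnorm (A + B) <= mxnorm A + mxnorm B.
Proof.
apply: mxnorm_le => [|w]; first exact: addr_ge0.
rewrite mulmxDl (le_trans (mxnorm2D_col _ _))// mulrDl.
by apply: lerD; exact: mxnormP.
Qed.

Lemma mxnormZ k l a (A : 'M[R[i]]_(k, l)) : mxnorm (a *: A) <= cabs a * mxnorm A.
Proof.
apply: mxnorm_le => [|w]; first by rewrite mulr_ge0// cabs_ge0.
by rewrite -scalemxAl mxnorm2Z -mulrA ler_wpM2l ?cabs_ge0//; exact: mxnormP.
Qed.

Lemma mxnormN k l (A : 'M[R[i]]_(k, l)) : mxnorm (- A) = mxnorm A.
Proof.
have h (B : 'M[R[i]]_(k, l)) : mxnorm (- B) <= mxnorm B.
  by apply: mxnorm_le => // w; rewrite mulNmx mxnorm2N; exact: mxnormP.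
apply/le_anti/andP; split; first exact: h A.
by have := h (- A); rewrite opprK; exact.
Qed.

Lemma mxnormB k l (A B : 'M[R[i]]_(k, l)) :
  mxnorm (A - B) <= mxnorm A + mxnorm B.
Proof. by rewrite -[mxnorm B]mxnormN; exact: mxnormD. Qed.

Lemma mxnorm0 k l : mxnorm (0 : 'M[R[i]]_(k, l)) = 0.
Proof.
apply/le_anti; rewrite mxnorm_ge0 andbT; apply: mxnorm_le => // w.
by rewrite mul0mx mxnorm20 mul0r.
Qed.

Lemma mxnorm_sum k l I (r : seq I) (P : pred I) (F : I -> 'M[R[i]]_(k, l)) :
  mxnorm (\sum_(i <- r | P i) F i) <= \sum_(i <- r | P i) mxnorm (F i).
Proof.
elim/big_rec2: _ => [|i y1 y2 _ h]; first by rewrite mxnorm0.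
by rewrite (le_trans (mxnormD _ _))// lerD2l.
Qed.

(** From |A^* w|^2 = <w, A A^* w>. *)
Lemma mxnorm_adj k l (A : 'M[R[i]]_(k, l)) : mxnorm (A^t*) <= mxnorm A.
Proof.
apply: mxnorm_le => // w.
have [->|w0] := eqVneq (A^t* *m w) 0; first by rewrite mxnorm20 mulr_ge0.
have h : 0 < mxnorm2 (A^t* *m w) by rewrite lt0r mxnorm2_eq0 w0 mxnorm2_ge0.
rewrite -(ler_pM2r h) -expr2 sqr_mxnorm2_Re adjmxM adjmxK -mulmxA.
rewrite (le_trans (ler_norm _))// (le_trans (Re_le_cabs _))//.
rewrite (le_trans (cauchy_schwarz_col _ _))// mulrC mulrAC ler_wpM2r//.
exact: mxnormP.
Qed.

Lemma mxnorm_coisometry k l (A : 'M[R[i]]_(k, l)) : A *m A^t* = 1%:M -> mxnorm A <= 1.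
Proof.
move=> h; rewrite -[A]adjmxK (le_trans (mxnorm_adj _))//.
apply: mxnorm_le => // w; rewrite mul1r le_mxnorm2 !sqr_mxnorm2_Re.
by rewrite adjmxM adjmxK -mulmxA (mulmxA A) h mul1mx.
Qed.

Lemma cabs_le_mxnorm k l (A : 'M[R[i]]_(k, l)) i j : cabs (A i j) <= mxnorm A.
Proof.
have -> : A i j = (A *m (delta_mx j 0 : 'cV[R[i]]_l)) i 0.
  by rewrite -colE mxE.
rewrite (le_trans (cabs_le_mxnorm2 _ _ _))// (le_trans (mxnormP _ _))//.
by rewrite mxnorm2_delta mulr1.
Qed.

Lemma mxnorm_le_sum k l (A : 'M[R[i]]_(k, l)) :
  mxnorm A <= \sum_i \sum_j cabs (A i j).
Proof.
have h0 : 0 <= \sum_i \sum_j cabs (A i j).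
  by apply: sumr_ge0 => i _; apply: sumr_ge0 => j _; exact: cabs_ge0.
apply: mxnorm_le => // w.
rewrite (le_trans (mxnorm2_mulmx_col _ _))// ler_wpM2r//.
rewrite -(ler_pXn2r (n := 2))// ?nnegrE// sqr_mxnorm2 !pair_big/=.
set a := fun p : 'I_k * 'I_l => cabs (A p.1 p.2).
have a0 (p : 'I_k * 'I_l) : 0 <= a p by exact: cabs_ge0.
rewrite [leRHS]expr2 mulr_suml; apply: ler_sum => p _.
rewrite expr2 ler_wpM2l//= [leRHS](bigD1 p)//= lerDl.
by apply: sumr_ge0 => q _; exact: cabs_ge0.
Qed.

Lemma mxnorm_trace n (A : 'M[R[i]]_n) : cabs (\tr A) <= n%:R * mxnorm A.
Proof.
rewrite (le_trans (cabs_sum _ _ _))//.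
rewrite (le_trans (ler_sum _ (fun i _ => cabs_le_mxnorm A i i)))//.
by rewrite sumr_const card_ord mulr_natl.
Qed.

(** A product A B factoring through C^p has rank at most p: compressing it by an
    orthonormal basis of the row space of B leaves a p x p matrix, whose trace
    is at most p times its norm. *)
Lemma trace_rank_le p n (W : 'M[R[i]]_n) (A : 'M[R[i]]_(n, p)) (B : 'M[R[i]]_(p, n)) :
  row_free B -> cabs (\tr (W *m (A *m B))) <= p%:R * (mxnorm W * mxnorm (A *m B)).
Proof.
move=> fB; have pn : (p <= n)%N by rewrite -(eqP fB) rank_leq_col.
set Q := schmidt B; have /unitarymxP QQ : Q \is unitarymx by exact: schmidt_unitarymx.
have /submxP[S hS] : (B <= Q)%MS by exact: schmidt_sub.
have -> : \tr (W *m (A *m B)) = \tr (Q *m W *m (A *m B) *m Q^t*).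
  rewrite -!mulmxA (mxtrace_mulC Q) -!mulmxA; congr (\tr (_ *m (_ *m _))).
  by rewrite hS -!mulmxA (mulmxA Q) QQ mul1mx.
rewrite (le_trans (mxnorm_trace _))// ler_wpM2l//.
have hQ : mxnorm Q <= 1 by exact: mxnorm_coisometry.
have hQ' : mxnorm (Q^t*) <= 1 by rewrite (le_trans (mxnorm_adj _)).
apply: le_trans (mxnormM _ _) _; apply: le_trans (ler_piMr _ hQ') _ => //.
apply: le_trans (mxnormM _ _) _; apply: ler_wpM2r; first exact: mxnorm_ge0.
apply: le_trans (mxnormM _ _) _; apply: ler_piMl hQ; exact: mxnorm_ge0.
Qed.

End OperatorNorm.
#[global] Hint Extern 0 (is_true (@Order.le _ _ (@Algebra.zero _) (mxnorm _))) =>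
  solve [exact: mxnorm_ge0] : core.

#[global] Opaque mxnorm mxnorm2.

(** * Pencils with a degenerate spectral parameter *)

(** If y t > (C + s) F, then F > s t because y t^2 <= F (F + C t), whence
    s F >= s^2 t >= y t, a contradiction. *)
Lemma quadratic_bound (R : realType) (y t F C s : R) :
  0 < y -> 0 <= t -> 0 <= F -> 0 <= C -> 0 <= s ->
  y * t ^+ 2 <= F * (F + C * t) -> y <= s ^+ 2 -> t <= (C + s) / y * F.
Proof.
move=> y0 t0 F0 C0 s0 ty s2; rewrite mulrAC ler_pdivlMr// mulrC leNgt; apply/negP => h.
have CF : 0 <= C * F by exact: mulr_ge0.
have [te|tn] := eqVneq t 0.
  by have sF := mulr_ge0 s0 F0; rewrite te in h; lra.
have t1 : 0 < t by rewrite lt0r tn.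
have h2 : ((C + s) * F) * t < y * t ^+ 2 by rewrite expr2 mulrA ltr_pM2r.
have h3 : s * t < F.
  have h3' : F * (s * t) < F * F by lra.
  have [Fe|Fn] := eqVneq F 0; first by rewrite Fe !mul0r ltxx in h3'.
  have Fp : 0 < F by rewrite lt0r Fn.
  by rewrite ltr_pM2l in h3'.
have h4 : s * (s * t) <= s * F by exact: ler_wpM2l (ltW h3).
have h5 : y * t <= s ^+ 2 * t by exact: ler_wpM2r.
lra.
Qed.

(** P stands for e_11 (x) 1 and J for diag (0, 1, -1) (x) 1, so that Lambda (x) 1
    is z P - J. The spectral parameter z is degenerate: it acts on the range of P
    only. The relation J X J^2 = 0 says that X vanishes on the complement of that
    range, compressed to it. *)
Section GeneralizedResolvent.
Context {R : realType} {n : nat} (X P J : 'M[R[i]]_n) (c : R).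
Context (PJ : P + J *m J = 1%:M) (JP : J *m P = 0) (PP : P *m P = P).
Context (JXJ : J *m X *m (J *m J) = 0).
Context (adjP : P^t* = P) (adjJ : J^t* = J) (adjX : X^t* = X).
Context (c0 : 0 <= c) (Xc : mxnorm X <= c).
Implicit Types (z : R[i]) (w f : 'cV[R[i]]_n) (tau : R).

Definition pencil z : 'M[R[i]]_n := X - z *: P + J.

Lemma pythagoras w : mxnorm2 (P *m w) ^+ 2 + mxnorm2 (J *m w) ^+ 2 = mxnorm2 w ^+ 2.
Proof.
transitivity (complex.Re (((P *m w)^t* *m (P *m w)) 0 0)
    + complex.Re (((J *m w)^t* *m (J *m w)) 0 0)).
  by congr (_ + _); exact: sqr_mxnorm2_Re.
rewrite (sqr_mxnorm2_Re w) (adjmxM P w) (adjmxM J w) adjP adjJ -cReD.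
have -> : w^t* *m w = w^t* *m P *m (P *m w) + w^t* *m J *m (J *m w).
  rewrite -!mulmxA (mulmxA P P) (mulmxA J J) PP -mulmxDr -mulmxDl PJ.
  by rewrite mul1mx.
by rewrite [in RHS]mxE.
Qed.

Lemma mxnorm2_proj w : mxnorm2 (P *m w) <= mxnorm2 w.
Proof. by rewrite le_mxnorm2 -(pythagoras w) lerDl sqr_ge0. Qed.

Lemma mxnorm2_sign w : mxnorm2 (J *m w) <= mxnorm2 w.
Proof. by rewrite le_mxnorm2 -(pythagoras w) lerDr sqr_ge0. Qed.

(** Multiplying the equation by J determines the part of w outside the range of P
    from the part inside. *)
Lemma pencil_split z w f : pencil z *m w = f ->
  w = P *m w + (J *m f - J *m (X *m (P *m w))).
Proof.
move=> <-; rewrite /pencil !mulmxDl mulNmx -scalemxAl !mulmxDr mulmxN -scalemxAr.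
rewrite (mulmxA J P) JP mul0mx scaler0 subr0.
have -> : J *m (X *m w) = J *m (X *m (P *m w)).
  rewrite -{1}[w]mul1mx -PJ mulmxDl !mulmxDr.
  have -> : J *m (X *m (J *m J *m w)) = 0 by rewrite (mulmxA X) (mulmxA J) (mulmxA J) JXJ mul0mx.
  by rewrite addr0.
by rewrite addrAC subrr add0r mulmxA -mulmxDl PJ mul1mx.
Qed.

Lemma hermitian_form_real (A : 'M[R[i]]_n) w : A^t* = A ->
  complex.Im ((w^t* *m (A *m w)) 0 0) = 0.
Proof.
move=> hA; have e : (w^t* *m (A *m w))^t* = w^t* *m (A *m w).
  by rewrite !adjmxM adjmxK hA mulmxA.
have := congr1 (fun M : 'M[R[i]]_1 => complex.Im (M 0 0)) e.
rewrite adjmxE; case: ((w^t* *m (A *m w)) 0 0) => a b /= h.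
lra.
Qed.

Lemma pencil_Im z w f : pencil z *m w = f ->
  complex.Im z * mxnorm2 (P *m w) ^+ 2 = - complex.Im ((w^t* *m f) 0 0).
Proof.
move=> <-; rewrite /pencil !mulmxDl mulNmx -scalemxAl !mulmxDr mulmxN -scalemxAr.
have addE (A B : 'M[R[i]]_1) : (A + B) 0 0 = A 0 0 + B 0 0 by rewrite mxE.
have subE (A : 'M[R[i]]_1) : (- A) 0 0 = - A 0 0 by rewrite mxE.
have scE a (A : 'M[R[i]]_1) : (a *: A) 0 0 = a * A 0 0 by rewrite mxE.
rewrite !addE subE scE !cImD cImN !hermitian_form_real// add0r addr0 opprK cImM.
rewrite hermitian_form_real// mulr0 add0r sqr_mxnorm2_Re adjmxM adjP.
by rewrite -mulmxA (mulmxA P P) PP.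
Qed.

Definition resolvent_const tau : R := 1 + c + Num.sqrt tau.

Section Bounds.
Context (z : R[i]) (tau : R).
Context (y0 : 0 < complex.Im z) (yt : complex.Im z <= tau).

Lemma pencil_rest w f : pencil z *m w = f ->
  mxnorm2 (w - J *m f) <= (1 + c) * mxnorm2 (P *m w).
Proof.
move=> hw.
have -> : w - J *m f = P *m w - J *m (X *m (P *m w)).
  rewrite {1}(pencil_split hw) -addrA; congr (_ + _).
  by rewrite addrAC subrr add0r.
apply: le_trans (mxnorm2B_col _ _) _; rewrite mulrDl mul1r lerD2l.
apply: le_trans (mxnorm2_sign _) _; exact: mxnorm2_mulmx_le.
Qed.

Lemma pencil_le w f : pencil z *m w = f ->
  mxnorm2 w <= mxnorm2 f + (1 + c) * mxnorm2 (P *m w).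
Proof.
move=> hw; have -> : w = J *m f + (w - J *m f) by rewrite addrC subrK.
apply: le_trans (mxnorm2D_col _ _) _; apply: lerD; first exact: mxnorm2_sign.
by rewrite -[J *m f + _]addrC subrK; exact: pencil_rest.
Qed.

(** The imaginary part of the pencil is - Im z P; it controls the part of the
    solution in the range of P, from which the rest is recovered. *)
Lemma pencil_proj_le w f : pencil z *m w = f ->
  mxnorm2 (P *m w) <= resolvent_const tau / complex.Im z * mxnorm2 f.
Proof.
move=> hw; set t := mxnorm2 (P *m w); set y := complex.Im z.
have t0 : 0 <= t by exact: mxnorm2_ge0.
have f0 : 0 <= mxnorm2 f by exact: mxnorm2_ge0.
have ty : y * t ^+ 2 <= mxnorm2 f * (mxnorm2 f + (1 + c) * t).
  rewrite (pencil_Im hw); apply: le_trans (ler_norm _) _; rewrite normrN.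
  apply: le_trans (Im_le_cabs _) _; apply: le_trans (cauchy_schwarz_col _ _) _.
  by rewrite mulrC ler_wpM2l//; exact: pencil_le.
apply: (quadratic_bound y0 t0 f0 _ (sqrtr_ge0 tau) ty); first exact: addr_ge0.
by rewrite sqr_sqrtr//; exact: le_trans (ltW y0) yt.
Qed.

Lemma mulmx_inj_unitmx (A : 'M[R[i]]_n) :
  (forall w, A *m w = 0 -> w = 0) -> A \in unitmx.
Proof.
move=> h; rewrite -unitmx_tr -row_free_unit; apply: inj_row_free => v hv.
apply: trmx_inj; rewrite trmx0; apply: h.
by rewrite -[A]trmxK -trmx_mul hv trmx0.
Qed.

Lemma pencil_unit : pencil z \in unitmx.
Proof.
apply: mulmx_inj_unitmx => w hw.
have := pencil_proj_le hw; rewrite mxnorm20 mulr0 => h.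
have Pw : P *m w = 0.
  by apply/eqP; rewrite -mxnorm2_eq0; apply/eqP/le_anti; rewrite h mxnorm2_ge0.
by rewrite (pencil_split hw) Pw !mulmx0 subrr addr0.
Qed.

Let pencilK w : pencil z *m (invmx (pencil z) *m w) = w.
Proof. by rewrite mulmxA mulmxV ?pencil_unit// mul1mx. Qed.

Let rc0 : 0 <= resolvent_const tau / complex.Im z.
Proof.
apply: divr_ge0; last exact: ltW.
by rewrite /resolvent_const !addr_ge0// sqrtr_ge0.
Qed.

Lemma resolvent_sub_sign_le :
  mxnorm (invmx (pencil z) - J) <= (1 + c) * (resolvent_const tau / complex.Im z).
Proof.
have c1 : 0 <= 1 + c by rewrite addr_ge0.
apply: mxnorm_le => [|f]; first by rewrite mulr_ge0.
rewrite mulmxBl; apply: le_trans (pencil_rest (pencilK f)) _.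
by rewrite -mulrA ler_wpM2l//; exact: pencil_proj_le.
Qed.

Lemma resolvent_le :
  mxnorm (invmx (pencil z)) <= (tau + (1 + c) * resolvent_const tau) / complex.Im z.
Proof.
have c1 : 0 <= 1 + c by rewrite addr_ge0.
have t0 : 0 < tau by exact: lt_le_trans yt.
rewrite mulrDl; apply: mxnorm_le => [|f].
  by rewrite -mulrA; apply: addr_ge0; [apply: divr_ge0; exact: ltW|exact: mulr_ge0].
apply: le_trans (pencil_le (pencilK f)) _; rewrite mulrDl; apply: lerD.
  by rewrite ler_peMl// ler_pdivlMr// mul1r.
by rewrite -!mulrA ler_wpM2l// mulrA; exact: pencil_proj_le.
Qed.

(** Summing the squared bounds on the columns of the resolvent: the squared norms
    of their projections, multiplied by Im z, add up to the imaginary part of the trace. *)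
Lemma resolvent_mxnorm2_le :
  mxnorm2 (invmx (pencil z)) ^+ 2 <=
  2 * n%:R + 2 * (1 + c) ^+ 2 * (complex.Im (\tr (invmx (pencil z))) / complex.Im z).
Proof.
have c1 : 0 <= 1 + c by rewrite addr_ge0.
rewrite sqr_mxnorm2_cols.
have -> : 2 * n%:R = \sum_(j < n) 2 :> R by rewrite sumr_const card_ord mulr_natr.
rewrite cIm_sum mulr_suml mulr_sumr -big_split/=; apply: ler_sum => j _.
rewrite colE; set w := invmx _ *m _.
have hw : pencil z *m w = delta_mx j 0 by rewrite /w pencilK.
have := pencil_Im hw; have := pencil_le hw; rewrite mxnorm2_delta.
have -> : (w^t* *m (delta_mx j 0 : 'cV[R[i]]_n)) 0 0 = ((invmx (pencil z)) j j)^*.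
  rewrite -(colE j (w^t*)) mxE adjmxE; congr conjc.
  by rewrite /w -(colE j (invmx (pencil z))) mxE.
have := mxnorm2_ge0 (P *m w); have := mxnorm2_ge0 w.
move: (mxnorm2 w) (mxnorm2 (P *m w)) => W T w0 T0 hW.
case: (invmx _ j j) => a b /=; rewrite opprK => <-.
rewrite [_ * T ^+ 2]mulrC mulfK ?gt_eqF//.
have h : W ^+ 2 <= (1 + (1 + c) * T) ^+ 2.
  by rewrite ler_pXn2r// ?nnegrE// addr_ge0// mulr_ge0.
(* (1 + u)^2 <= 2 + 2 u^2 *)
apply: le_trans h _; move: (1 + c) c1 => C C0.
by have := sqr_ge0 (1 - C * T); nra.
Qed.

End Bounds.

Lemma resolvent_sub (z z' : R[i]) : pencil z \in unitmx -> pencil z' \in unitmx ->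
  invmx (pencil z) - invmx (pencil z') =
  (z - z') *: (invmx (pencil z) *m P *m invmx (pencil z')).
Proof.
move=> u u'.
have e : pencil z' - pencil z = (z - z') *: P.
  by rewrite /pencil scalerBl; apply/matrixP => i j; rewrite !mxE; ring.
rewrite -mulmx_scale_mid -e mulmxBr mulmxBl (mulVmx u) mul1mx -mulmxA (mulmxV u').
by rewrite mulmx1.
Qed.

Lemma mxnorm_proj : mxnorm P <= 1.
Proof. by apply: mxnorm_le => // w; rewrite mul1r mxnorm2_proj. Qed.

End GeneralizedResolvent.

(** * Kronecker products *)

Section Tensor.
Context {R : realType}.
Implicit Types (m n p q : nat).

Lemma tensmxDl m n p q (A B : 'M[R[i]]_(m, n)) (C : 'M[R[i]]_(p, q)) :
  (A + B) *t C = A *t C + B *t C.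
Proof. by apply/matrixP => i j; rewrite !mxE mulrDl. Qed.

Lemma tensmxDr m n p q (A : 'M[R[i]]_(m, n)) (B C : 'M[R[i]]_(p, q)) :
  A *t (B + C) = A *t B + A *t C.
Proof. by apply/matrixP => i j; rewrite !mxE mulrDr. Qed.

Lemma tensmxNl m n p q (A : 'M[R[i]]_(m, n)) (C : 'M[R[i]]_(p, q)) :
  (- A) *t C = - (A *t C).
Proof. by apply/matrixP => i j; rewrite !mxE mulNr. Qed.

Lemma tensmxZl m n p q a (A : 'M[R[i]]_(m, n)) (C : 'M[R[i]]_(p, q)) :
  (a *: A) *t C = a *: (A *t C).
Proof. by apply/matrixP => i j; rewrite !mxE mulrA. Qed.

Lemma tensmx_sumr m n p q I (r : seq I) (A : 'M[R[i]]_(m, n))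
    (F : I -> 'M[R[i]]_(p, q)) :
  A *t (\sum_(i <- r) F i) = \sum_(i <- r) A *t F i.
Proof.
elim: r => [|x r IH]; first by rewrite !big_nil tensmx0.
by rewrite !big_cons tensmxDr IH.
Qed.

Lemma tensmx_suml m n p q I (r : seq I) (C : 'M[R[i]]_(p, q))
    (F : I -> 'M[R[i]]_(m, n)) :
  (\sum_(i <- r) F i) *t C = \sum_(i <- r) F i *t C.
Proof.
elim: r => [|x r IH]; first by rewrite !big_nil tens0mx.
by rewrite !big_cons tensmxDl IH.
Qed.

Lemma adjmx_tens m n p q (A : 'M[R[i]]_(m, n)) (B : 'M[R[i]]_(p, q)) :
  (A *t B)^t* = (A^t*) *t (B^t*).
Proof. by rewrite trmx_tens map_mxT. Qed.

Lemma tens11 m n : (1%:M : 'M[R[i]]_m) *t (1%:M : 'M[R[i]]_n) = 1%:M.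
Proof.
apply/matrixP => i j; case: (mxtens_indexP i) => i0 i1.
case: (mxtens_indexP j) => j0 j1; rewrite tensmxE !mxE -natrM mulnb.
by rewrite -xpair_eqE (inj_eq (can_inj (@mxtens_indexK _ _))).
Qed.

Lemma big_mxtens m p (F : 'I_(m * p) -> R) :
  \sum_k F k = \sum_i \sum_j F (mxtens_index (i, j)).
Proof.
rewrite pair_big/=; rewrite (reindex (fun ij : 'I_m * 'I_p => mxtens_index ij))/=.
  by apply: eq_bigr => -[].
by exists (@mxtens_unindex m p) => k _; rewrite (mxtens_indexK, mxtens_unindexK).
Qed.

(** The matrix 1 (x) B acts on every slice of a vector as B does. *)
Lemma mxnorm_tens1 m p q (B : 'M[R[i]]_(p, q)) :
  mxnorm ((1%:M : 'M[R[i]]_m) *t B) <= mxnorm B.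
Proof.
apply: mxnorm_le => // w; apply: le_of_sqr; first by rewrite mulr_ge0.
pose s (i : 'I_m) : 'cV[R[i]]_q := \col_b w (mxtens_index (i, b)) 0.
rewrite exprMn !sqr_mxnorm2_col !big_mxtens mulr_sumr; apply: ler_sum => i _.
have -> : \sum_j cabs (w (mxtens_index (i, j)) 0) ^+ 2 = mxnorm2 (s i) ^+ 2.
  by rewrite sqr_mxnorm2_col; apply: eq_bigr => j _; rewrite mxE.
have -> : \sum_j cabs (((1%:M *t B) *m w) (mxtens_index (i, j)) 0) ^+ 2 =
          mxnorm2 (B *m s i) ^+ 2.
  rewrite sqr_mxnorm2_col; apply: eq_bigr => j _; congr (cabs _ ^+ 2).
  rewrite !mxE (reindex (fun ij : 'I_m * 'I_q => mxtens_index ij))/=; last first.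
    by exists (@mxtens_unindex m q) => k _; rewrite (mxtens_indexK, mxtens_unindexK).
  rewrite (eq_bigr (fun ij : 'I_m * 'I_q =>
    (i == ij.1)%:R * B j ij.2 * w (mxtens_index (ij.1, ij.2)) 0)); last first.
    by case=> a b _; rewrite tensmxE mxE.
  rewrite -(pair_big xpredT xpredT (fun a b =>
    (i == a)%:R * B j b * w (mxtens_index (a, b)) 0))/= (bigD1 i)//=.
  rewrite [X in _ + X]big1 ?addr0 => [|a ai]; last first.
    by rewrite big1// => b _; rewrite eq_sym (negPf ai) !mul0r.
  by apply: eq_bigr => b _; rewrite eqxx mul1r mxE.
rewrite -exprMn ler_pXn2r ?nnegrE ?mulr_ge0//; exact: mxnormP.
Qed.

(** The matrix e_ij (x) 1 is a product of a coisometry with the adjoint of one. *)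
Lemma mxnorm_tensE m p (i j : 'I_m) :
  mxnorm ((delta_mx i j : 'M[R[i]]_m) *t (1%:M : 'M[R[i]]_p)) <= 1.
Proof.
have co (k : 'I_m) : mxnorm ((row k 1%:M : 'rV[R[i]]_m) *t (1%:M : 'M[R[i]]_p)) <= 1.
  apply: mxnorm_coisometry; rewrite adjmx_tens adjmx1 tensmx_mul mulmx1.
  have -> : row k 1%:M *m (row k 1%:M)^t* = 1%:M :> 'M[R[i]]_1.
    rewrite -row_mul mul1mx; apply/matrixP => a b.
    by rewrite !ord1 !mxE !eqxx rmorph1.
  exact: tens11.
have -> : (delta_mx i j : 'M[R[i]]_m) *t (1%:M : 'M[R[i]]_p) =
   ((row i 1%:M : 'rV[R[i]]_m) *t (1%:M : 'M[R[i]]_p))^t* *m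
   ((row j 1%:M : 'rV[R[i]]_m) *t (1%:M : 'M[R[i]]_p)).
  rewrite adjmx_tens adjmx1 tensmx_mul mulmx1; congr (_ *t _).
  apply/matrixP => a b; rewrite !mxE big_ord1 !mxE rmorph_nat -natrM mulnb.
  by rewrite eq_sym [b == j]eq_sym.
apply: le_trans (mxnormM _ _) _; apply: mulr_ile1 => //.
exact: le_trans (mxnorm_adj _) _.
Qed.

Lemma mxnorm_tens_le m p (A : 'M[R[i]]_m) (B : 'M[R[i]]_p) :
  mxnorm (A *t B) <= (\sum_i \sum_j cabs (A i j)) * mxnorm B.
Proof.
rewrite tensmx_decr; apply: le_trans (mxnormM _ _) _.
apply: ler_pM => //; last exact: mxnorm_tens1.
rewrite {1}[A]matrix_sum_delta tensmx_suml; apply: le_trans (mxnorm_sum _ _ _) _.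
apply: ler_sum => i _; rewrite tensmx_suml; apply: le_trans (mxnorm_sum _ _ _) _.
apply: ler_sum => j _; rewrite tensmxZl; apply: le_trans (mxnormZ _ _) _.
by apply: ler_piMr => //; exact: mxnorm_tensE.
Qed.

End Tensor.

(** * Slices and partial traces *)

Section Slices.
Context {R : realType} {N : nat}.
Implicit Types (i j : 'I_N).

Let r i : 'rV[R[i]]_N := row i 1%:M.
Let r' i : 'M[R[i]]_(N.-1, N) := row' i 1%:M.

Lemma row1_adj i : r i *m (r i)^t* = 1%:M.
Proof.
rewrite -row_mul mul1mx; apply/matrixP => a b.
by rewrite !ord1 !mxE !eqxx rmorph1.
Qed.

Lemma rowE1 n (M : 'M[R[i]]_(N, n)) i : r i *m M = row i M.
Proof. by rewrite -row_mul mul1mx. Qed.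

Lemma row'E1 n (M : 'M[R[i]]_(N, n)) i : r' i *m M = row' i M.
Proof. by apply/matrixP => a b; rewrite [in RHS]mxE -{2}[M]mul1mx !mxE; apply: eq_bigr => k _; rewrite !mxE. Qed.

Lemma row'1_adj i : r' i *m (r' i)^t* = 1%:M.
Proof.
rewrite row'E1; apply/matrixP => a b; rewrite !mxE (inj_eq lift_inj) eq_sym.
exact: rmorph_nat.
Qed.

Lemma row1_row'1_adj i : r i *m (r' i)^t* = 0.
Proof.
rewrite rowE1; apply/matrixP => a b; rewrite !mxE eq_sym (negPf (neq_lift _ _)).
exact: rmorph0.
Qed.

Lemma row1_split i : (r i)^t* *m r i + (r' i)^t* *m r' i = 1%:M.
Proof.
apply/matrixP => a b; rewrite !mxE big_ord1 !mxE rmorph_nat.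
rewrite (eq_bigr (fun k => (lift i k == a)%:R * (lift i k == b)%:R)); last first.
  by move=> k _; rewrite !mxE rmorph_nat.
case: (unliftP i a) => [a' ->|->].
  rewrite (negPf (neq_lift _ _)) mul0r add0r (bigD1 a')//= eqxx mul1r.
  rewrite big1 ?addr0// => k ka; rewrite (inj_eq lift_inj) (negPf ka) mul0r//.
rewrite eqxx mul1r big1 ?addr0// => k _.
by rewrite eq_sym (negPf (neq_lift _ _)) mul0r.
Qed.

Lemma bfe_adj i : bfe i *m (bfe i)^t* = 1%:M :> 'M[R[i]]_(3 * 1).
Proof. by rewrite adjmx_tens adjmx1 tensmx_mul mulmx1 row1_adj tens11. Qed.

Lemma bfehat_adj i : bfehat i *m (bfehat i)^t* = 1%:M :> 'M[R[i]]_(3 * N.-1).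
Proof. by rewrite adjmx_tens adjmx1 tensmx_mul mulmx1 row'1_adj tens11. Qed.

Lemma bfe_bfehat i : bfe i *m (bfehat i)^t* = 0 :> 'M[R[i]]_(3 * 1, 3 * N.-1).
Proof. by rewrite adjmx_tens adjmx1 tensmx_mul row1_row'1_adj tensmx0. Qed.

Lemma bfehat_bfe i : bfehat i *m (bfe i)^t* = 0 :> 'M[R[i]]_(3 * N.-1, 3 * 1).
Proof.
rewrite -[LHS]adjmxK adjmxM adjmxK bfe_bfehat.
by rewrite trmx0 map_mx0.
Qed.

Lemma bfe_split i :
  (bfe i)^t* *m bfe i + (bfehat i)^t* *m bfehat i = 1%:M :> 'M[R[i]]_(3 * N).
Proof.
by rewrite !adjmx_tens adjmx1 !tensmx_mul !mulmx1 -tensmxDr row1_split tens11.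
Qed.

Lemma mxnorm_bfe i : mxnorm (bfe i : 'M[R[i]]_(_, _)) <= 1.
Proof. exact: mxnorm_coisometry (bfe_adj i). Qed.

Lemma mxnorm_bfehat i : mxnorm (bfehat i : 'M[R[i]]_(_, _)) <= 1.
Proof. exact: mxnorm_coisometry (bfehat_adj i). Qed.

Lemma bfe_tens1 (A : 'M[R[i]]_3) i :
  bfe i *m (A *t 1%:M) *m (bfe i)^t* = A *t (1%:M : 'M[R[i]]_1).
Proof. by rewrite adjmx_tens adjmx1 !tensmx_mul mul1mx !mulmx1 row1_adj. Qed.

Lemma bfehat_tens1 (A : 'M[R[i]]_3) i :
  bfehat i *m (A *t 1%:M) *m (bfehat i)^t* = A *t (1%:M : 'M[R[i]]_N.-1).
Proof. by rewrite adjmx_tens adjmx1 !tensmx_mul mul1mx !mulmx1 row'1_adj. Qed.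

Lemma bfehat_tens1_bfe (A : 'M[R[i]]_3) i :
  bfehat i *m (A *t 1%:M) *m (bfe i)^t* = 0.
Proof.
rewrite adjmx_tens adjmx1 !tensmx_mul mul1mx !mulmx1.
suff -> : row' i 1%:M *m (row i 1%:M)^t* = 0 :> 'M[R[i]]_(_, 1) by rewrite tensmx0.
by rewrite -[LHS]adjmxK adjmxM adjmxK row1_row'1_adj trmx0 map_mx0.
Qed.

Lemma bfe_tens1_bfehat (A : 'M[R[i]]_3) i :
  bfe i *m (A *t 1%:M) *m (bfehat i)^t* = 0.
Proof.
by rewrite adjmx_tens adjmx1 !tensmx_mul mul1mx !mulmx1 row1_row'1_adj tensmx0.
Qed.

(** Used to pass between the convertible types 'M_3 and 'M_(3 * 1). *)
Lemma tens_mx11 (A : 'M[R[i]]_3) : (A *t (1%:M : 'M[R[i]]_1) : 'M[R[i]]_3) = A.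
Proof.
apply/matrixP => a b; rewrite mxE !mxE.
have -> : (mxtens_unindex (m := 3) (n := 1) a).1 = a by apply: val_inj; rewrite /= divn1.
have -> : (mxtens_unindex (m := 3) (n := 1) b).1 = b by apply: val_inj; rewrite /= divn1.
have ord1_eq (x y : 'I_1) : x == y by rewrite (ord1 x) (ord1 y).
by rewrite ord1_eq mulr1.
Qed.

(** The sum of the diagonal 3 x 3 blocks of D is its partial trace, which is
    determined by its pairings with the matrices A (x) 1. *)
Lemma partial_trace (A : 'M[R[i]]_3) (D : 'M[R[i]]_(3 * N)) :
  \tr (A *m (\sum_j (bfe j *m D *m (bfe j)^t*) : 'M[R[i]]_3)) =
  \tr ((A *t 1%:M) *m D).
Proof.
rewrite mulmx_sumr raddf_sum/=.
have -> : (1%:M : 'M[R[i]]_N) = \sum_j (r j)^t* *m r j.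
  apply/matrixP => a b; rewrite summxE (bigD1 a)//= big1 => [|j ja].
    by rewrite addr0 !mxE big_ord1 !mxE eqxx rmorph1 mul1r.
  by rewrite !mxE big_ord1 !mxE (negPf ja) rmorph0 mul0r.
rewrite tensmx_sumr mulmx_suml raddf_sum/=; apply: eq_bigr => j _.
transitivity (\tr ((A *t (1%:M : 'M[R[i]]_1)) *m (bfe j *m D *m (bfe j)^t*))).
  by rewrite -{1}[A]tens_mx11.
rewrite !mulmxA mxtrace_mulC !mulmxA; congr (\tr (_ *m _)).
by rewrite adjmx_tens adjmx1 !tensmx_mul mul1mx !mulmx1.
Qed.

(** The factor 9 counts the entries of a 3 x 3 matrix. *)
Lemma mxnorm_partial_trace (D : 'M[R[i]]_(3 * N)) (b : R) :
  (forall W : 'M[R[i]]_(3 * N), mxnorm W <= 1 -> cabs (\tr (W *m D)) <= b) ->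
  mxnorm (\sum_j (bfe j *m D *m (bfe j)^t*) : 'M[R[i]]_3) <= 9 * b.
Proof.
move=> hb; set S : 'M[R[i]]_3 := \sum_j _; apply: le_trans (mxnorm_le_sum _) _.
have e k l : S k l = \tr (delta_mx l k *m S).
  rewrite /mxtrace (bigD1 l)//= big1 => [|a al]; last first.
    by rewrite mxE big1// => b' _; rewrite mxE (negPf al) mul0r.
  rewrite addr0 mxE (bigD1 k)//= big1 => [|b' bk]; last first.
    by rewrite mxE (negPf bk) andbF mul0r.
  by rewrite mxE !eqxx mul1r addr0.
have -> : 9 * b = \sum_(k < 3) \sum_(l < 3) b.
  by rewrite !big_ord_recl !big_ord0; ring.
apply: ler_sum => k _; apply: ler_sum => l _; rewrite e partial_trace.
by apply: hb; exact: mxnorm_tensE.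
Qed.

Lemma trace_partial_trace (D : 'M[R[i]]_(3 * N)) :
  \tr (\sum_j (bfe j *m D *m (bfe j)^t*) : 'M[R[i]]_3) = \tr D.
Proof. by have := partial_trace 1%:M D; rewrite tens11 !mul1mx. Qed.

End Slices.

(** * Linearization of the anticommutator *)

Section Linearization.
Context {R : realType}.

(** Lambda z = z projE - signE. *)
Definition projE : 'M[R[i]]_3 := delta_mx 0 0.
Definition signE : 'M[R[i]]_3 := diag3 0 1 (-1).

Lemma ord3_ind (P : 'I_3 -> Prop) : P 0 -> P 1 -> P 2 -> forall i, P i.
Proof.
move=> p0 p1 p2 [[|[|[|//]]] hi].
- by have -> : Ordinal hi = 0 by exact: val_inj.
- by have -> : Ordinal hi = 1 by exact: val_inj.
- by have -> : Ordinal hi = 2 by exact: val_inj.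
Qed.

Lemma sum3 (F : 'I_3 -> R[i]) : \sum_i F i = F 0 + F 1 + F 2.
Proof.
rewrite !big_ord_recl big_ord0 addr0 addrA; congr (F _ + F _ + F _);
exact: val_inj.
Qed.

Ltac mx3 := apply/matrixP; elim/ord3_ind; elim/ord3_ind;
  rewrite /projE /signE /Lambda /diag3 /e12 /e21 /e13 /e31
    ?(mxE, sum3)/= ?(mxE, sum3)/= ?rmorph0 ?rmorph1 ?rmorphN1;
  rewrite ?(mulr0, mul0r, mulr1, mul1r, addr0, add0r, mulr0n, mulr1n); try by []; ring.

Lemma LambdaE (z : R[i]) : Lambda z = z *: projE - signE. Proof. mx3. Qed.
Lemma projE_signE : projE + signE *m signE = 1%:M. Proof. mx3. Qed.
Lemma signE_projE : signE *m projE = 0. Proof. mx3. Qed.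
Lemma projE_idem : projE *m projE = projE. Proof. mx3. Qed.
Lemma projE_adj : projE^t* = projE. Proof. mx3. Qed.
Lemma signE_adj : signE^t* = signE. Proof. mx3. Qed.

(** The linearization is arm2 (x) (U - V)/sqrt 2 + arm3 (x) (- U - V)/sqrt 2. *)
Definition arm2 : 'M[R[i]]_3 := e12 + e21.
Definition arm3 : 'M[R[i]]_3 := e13 + e31.
Lemma arm2_adj : arm2^t* = arm2. Proof. rewrite /arm2; mx3. Qed.
Lemma arm3_adj : arm3^t* = arm3. Proof. rewrite /arm3; mx3. Qed.
Lemma sign_arm2_sign : signE *m arm2 *m signE = 0.
Proof. rewrite /arm2; mx3. Qed.
Lemma sign_arm3_sign : signE *m arm3 *m signE = 0.
Proof. rewrite /arm3; mx3. Qed.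
Lemma sign_arm2 : signE *m arm2 *m (signE *m signE) = 0.
Proof. by rewrite mulmxA sign_arm2_sign mul0mx. Qed.
Lemma sign_arm3 : signE *m arm3 *m (signE *m signE) = 0.
Proof. by rewrite mulmxA sign_arm3_sign mul0mx. Qed.

Lemma sum_cabs_arm2 : \sum_i \sum_j cabs (arm2 i j) = 2.
Proof.
rewrite !big_ord_recl !big_ord0 /arm2 /e12 /e21 !mxE /=.
by rewrite ?(addr0, add0r) !cabs0 !cabs1; ring.
Qed.
Lemma sum_cabs_arm3 : \sum_i \sum_j cabs (arm3 i j) = 2.
Proof.
rewrite !big_ord_recl !big_ord0 /arm3 /e13 /e31 !mxE /=.
by rewrite ?(addr0, add0r) !cabs0 !cabs1; ring.
Qed.

Section AtSize.
Context {N : nat} (U V : 'M[R[i]]_N).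
Context (hU : U^t* = U) (hV : V^t* = V) (nU : mxnorm U <= 4) (nV : mxnorm V <= 4).

Definition projN : 'M[R[i]]_(3 * N) := projE *t 1%:M.
Definition signN : 'M[R[i]]_(3 * N) := signE *t 1%:M.

Lemma projN_signN : projN + signN *m signN = 1%:M.
Proof. by rewrite tensmx_mul mul1mx -tensmxDl projE_signE tens11. Qed.
Lemma signN_projN : signN *m projN = 0.
Proof. by rewrite tensmx_mul mul1mx signE_projE tens0mx. Qed.
Lemma projN_idem : projN *m projN = projN.
Proof. by rewrite tensmx_mul mul1mx projE_idem. Qed.
Lemma projN_adj : projN^t* = projN.
Proof. by rewrite adjmx_tens projE_adj adjmx1. Qed.
Lemma signN_adj : signN^t* = signN.
Proof. by rewrite adjmx_tens signE_adj adjmx1. Qed.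

Lemma Lambda_tens (z : R[i]) :
  Lambda z *t 1%:M = z *: projN - signN :> 'M[R[i]]_(3 * N).
Proof. by rewrite LambdaE tensmxDl tensmxZl tensmxNl. Qed.

Lemma pencilE (z : R[i]) : Xmx U V - Lambda z *t 1%:M = pencil (Xmx U V) projN signN z.
Proof. by rewrite Lambda_tens /pencil opprB addrCA addrC addrAC. Qed.

Let a2 : 'M[R[i]]_N := sqrt2^-1 *: (U - V).
Let a3 : 'M[R[i]]_N := sqrt2^-1 *: (- U - V).

Lemma XmxE : Xmx U V = arm2 *t a2 + arm3 *t a3. Proof. by []. Qed.

Lemma sqrt2V_adj : Num.conj (sqrt2^-1 : R[i]) = sqrt2^-1.
Proof. by rewrite fmorphV; congr (_^-1); apply/conj_Creal; rewrite complex_real. Qed.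

Lemma Xmx_adj : (Xmx U V)^t* = Xmx U V.
Proof.
have scale_adj (W : 'M[R[i]]_N) : W^t* = W ->
    (sqrt2^-1 *: W)^t* = sqrt2^-1 *: W by rewrite adjmxZ sqrt2V_adj => ->.
have n2 : (U - V)^t* = U - V by rewrite (adjmxD U (- V)) (adjmxN V) hU hV.
have n3 : (- U - V)^t* = - U - V.
  by rewrite (adjmxD (- U) (- V)) (adjmxN U) (adjmxN V) hU hV.
rewrite XmxE adjmxD; congr (_ + _).
  by rewrite adjmx_tens arm2_adj (scale_adj _ n2).
by rewrite adjmx_tens arm3_adj (scale_adj _ n3).
Qed.

Lemma signN_Xmx : signN *m Xmx U V *m (signN *m signN) = 0.
Proof.
have h (E : 'M[R[i]]_3) (A : 'M[R[i]]_N) : signN *m (E *t A) *m (signN *m signN) =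
    (signE *m E *m (signE *m signE)) *t A.
  by rewrite !tensmx_mul !mul1mx !mulmx1.
rewrite XmxE (mulmxDr signN) (mulmxDl (signN *m _)) -[RHS]addr0; congr (_ + _).
  by rewrite h sign_arm2 tens0mx.
by rewrite h sign_arm3 tens0mx.
Qed.

Lemma cabs_sqrt2V : cabs (sqrt2^-1 : R[i]) <= 1.
Proof.
rewrite cabsV cabs_real ger0_norm ?sqrtr_ge0// invf_le1 ?sqrtr_gt0//.
by rewrite -[leLHS]sqrtr1 ler_sqrt// ler1n.
Qed.

(** Each of the two terms is at most 2 (4 + 4), as the entries of arm2 and of arm3
   sum to 2. *)
Lemma Xmx_norm : mxnorm (Xmx U V) <= 32.
Proof.
have h (A B : 'M[R[i]]_N) : mxnorm A <= 4 -> mxnorm B <= 4 ->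
    mxnorm (sqrt2^-1 *: (A + B)) <= 8.
  move=> hA hB; apply: le_trans (mxnormZ _ _) _.
  apply: le_trans (ler_piMl (mxnorm_ge0 _) cabs_sqrt2V) _.
  apply: le_trans (mxnormD _ _) _; by apply: le_trans (lerD hA hB) _; rewrite -natrD.
have n2 : mxnorm a2 <= 8 by apply: (h U (- V)); [exact: nU|rewrite (mxnormN V)].
have n3 : mxnorm a3 <= 8 by apply: (h (- U) (- V)); [rewrite (mxnormN U)|rewrite (mxnormN V)].
rewrite XmxE; apply: le_trans (mxnormD _ _) _.
apply: le_trans (lerD (mxnorm_tens_le _ _) (mxnorm_tens_le _ _)) _.
rewrite sum_cabs_arm2 sum_cabs_arm3.
by apply: le_trans (lerD (ler_wpM2l _ n2) (ler_wpM2l _ n3)) _; rewrite // -!natrM -natrD.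
Qed.

End AtSize.

(** Deleting an index turns the linearization of U and V into that of their
    principal submatrices, so that one analysis covers R and every R_i. *)
Lemma Xmx_minor N (U V : 'M[R[i]]_N) (i : 'I_N) :
  bfehat i *m Xmx U V *m (bfehat i)^t* =
  Xmx (row' i 1%:M *m U *m (row' i 1%:M)^t*) (row' i 1%:M *m V *m (row' i 1%:M)^t*).
Proof.
set r := row' i 1%:M.
have h (E : 'M[R[i]]_3) (A : 'M[R[i]]_N) :
    bfehat i *m (E *t A) *m (bfehat i)^t* = E *t (r *m A *m r^t*).
  by rewrite adjmx_tens adjmx1 !tensmx_mul mulmx1 mul1mx.
have h2 : r *m (U - V) *m r^t* = r *m U *m r^t* - r *m V *m r^t*.
  by rewrite (mulmxBr r) (mulmxBl (r *m U)).
have h3 : r *m (- U - V) *m r^t* = - (r *m U *m r^t*) - r *m V *m r^t*.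
  by rewrite (mulmxBr r) (mulmxBl (r *m - U)) (mulmxN r U) (mulNmx (r *m U)).
rewrite /Xmx (mulmxDr (bfehat i)) (mulmxDl (bfehat i *m _)).
congr (_ + _); rewrite h mulmx_scale_mid; congr (_ *t (_ *: _)).
  exact: h2.
exact: h3.
Qed.

Lemma minor_adj N (U : 'M[R[i]]_N) (i : 'I_N) : U^t* = U ->
  (row' i 1%:M *m U *m (row' i 1%:M)^t*)^t* = row' i 1%:M *m U *m (row' i 1%:M)^t*.
Proof. by move=> h; rewrite !adjmxM adjmxK h mulmxA. Qed.

Lemma minor_norm N (U : 'M[R[i]]_N) (i : 'I_N) (b : R) : mxnorm U <= b ->
  mxnorm (row' i 1%:M *m U *m (row' i 1%:M)^t*) <= b.
Proof.
have h1 : mxnorm (row' i 1%:M : 'M[R[i]]_(N.-1, N)) <= 1.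
  by apply: mxnorm_coisometry; exact: row'1_adj.
move=> h; apply: le_trans (mxnormM _ _) _.
apply: le_trans (ler_piMr (mxnorm_ge0 _) (le_trans (mxnorm_adj _) h1)) _.
apply: le_trans (mxnormM _ _) _; exact: le_trans (ler_piMl (mxnorm_ge0 _) h1) h.
Qed.

End Linearization.

(** * Schur complements *)

(** Block elimination. The columns of e' and h' form a basis, of which the rows
    of e and h are the dual basis; S inverts
    the compression of D by h, and T inverts D. *)
Section BlockElimination.
Context {F : fieldType} {n k l : nat}.
Context (D T : 'M[F]_n) (e : 'M[F]_(k, n)) (e' : 'M[F]_(n, k)).
Context (h : 'M[F]_(l, n)) (h' : 'M[F]_(n, l)) (S : 'M[F]_l).
Context (DT : D *m T = 1%:M) (SD : S *m (h *m D *m h') = 1%:M).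
Context (split1 : e' *m e + h' *m h = 1%:M).
Context (ee : e *m e' = 1%:M) (he : h *m e' = 0).

(** Multiply h D T = h by S and split T along e and h. *)
Lemma elimination : S *m h = h *m T + S *m (h *m D *m e') *m (e *m T).
Proof.
have dec : T = e' *m (e *m T) + h' *m (h *m T).
  by rewrite !mulmxA -mulmxDl split1 mul1mx.
have -> : S *m h = S *m (h *m D *m T) by rewrite -mulmxA DT mulmx1.
rewrite {1}dec !mulmxDr addrC; congr (_ + _); last by rewrite !mulmxA.
by rewrite -[RHS]mul1mx -SD !mulmxA.
Qed.

(** Deleting the indices of e changes the inverse by a matrix factoring through
    them. *)
Lemma elimination_diff :
  h' *m S *m h - T = - (e' - h' *m S *m (h *m D *m e')) *m (e *m T).
Proof.
have dec : T = e' *m (e *m T) + h' *m (h *m T).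
  by rewrite !mulmxA -mulmxDl split1 mul1mx.
rewrite -mulmxA elimination mulmxDr [X in _ - X = _]dec mulNmx mulmxBl opprB.
rewrite (addrC (e' *m _)) opprD addrACA subrr add0r; congr (_ - _).
by rewrite !mulmxA.
Qed.

Lemma schur : (e *m D *m e' - e *m D *m h' *m S *m (h *m D *m e')) *m
  (e *m T *m e') = 1%:M.
Proof.
have h1 : h *m T *m e' = - (S *m (h *m D *m e') *m (e *m T *m e')).
  apply/eqP; rewrite -addr_eq0; apply/eqP.
  have := congr1 (fun M => M *m e') elimination.
  by rewrite mulmxDl -(mulmxA S h) he mulmx0 !mulmxA => ->.
have h2 : e *m D *m e' *m (e *m T *m e') + e *m D *m h' *m (h *m T *m e') = 1%:M.
  have dec : T = e' *m (e *m T) + h' *m (h *m T).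
    by rewrite !mulmxA -mulmxDl split1 mul1mx.
  have <- : e *m D *m T *m e' = 1%:M by rewrite -(mulmxA e) DT mulmx1 ee.
  by rewrite [in RHS]dec mulmxDr mulmxDl !mulmxA.
by rewrite -h2 h1 mulmxN mulmxBl !mulmxA.
Qed.

End BlockElimination.

Section SchurComplement.
Context {R : realType}.

Lemma trace_budget (X I y g n n' : R) : 0 < n -> 0 < y -> n' <= n ->
  X <= 2 * (3 * n') + 2 * (1 + 32) ^+ 2 * (I / y) -> I <= n * (3 * g) ->
  X / n <= 6 + 6534 * (g / y).
Proof.
move=> n0 y0 nn hX hI; rewrite ler_pdivrMr//; apply: le_trans hX _.
have h : I / y <= n * (3 * (g / y)).
  by rewrite ler_pdivrMr// -mulrA -(mulrA 3) divfK ?gt_eqF.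
by move: (I / y) (g / y) h => p q h; lra.
Qed.

Definition resolvent_bound (tau : R) : R := tau + (1 + 32) * resolvent_const 32 tau.

Lemma resolvent_bound_ge0 (tau : R) : 0 <= tau -> 0 <= resolvent_bound tau.
Proof.
move=> t0; rewrite /resolvent_bound /resolvent_const.
by rewrite addr_ge0// mulr_ge0// !addr_ge0// sqrtr_ge0.
Qed.

Section Resolvents.
Context {N : nat} (U V : 'M[R[i]]_N).
Context (hU : U^t* = U) (hV : V^t* = V) (nU : mxnorm U <= 4) (nV : mxnorm V <= 4).
Context (z : R[i]) (y0 : 0 < complex.Im z).

Lemma denominator_unit : Xmx U V - Lambda z *t 1%:M \in unitmx.
Proof.
rewrite pencilE; exact: (pencil_unit projN_signN signN_projN projN_idem
  (signN_Xmx U V) projN_adj signN_adj (Xmx_adj hU hV) (ler0n _ 32)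
  (Xmx_norm nU nV) y0 (lexx _)).
Qed.

Context (tau : R) (yt : complex.Im z <= tau).

Lemma Rmx_le : mxnorm (Rmx U V z) <= resolvent_bound tau / complex.Im z.
Proof.
rewrite /Rmx pencilE; exact: (resolvent_le projN_signN signN_projN projN_idem
  (signN_Xmx U V) projN_adj signN_adj (Xmx_adj hU hV) (ler0n _ 32)
  (Xmx_norm nU nV) y0 yt).
Qed.

Lemma Rmx_sub_sign_le :
  mxnorm (Rmx U V z - signN) <= (1 + 32) * (resolvent_const 32 tau / complex.Im z).
Proof.
rewrite /Rmx pencilE; exact: (resolvent_sub_sign_le projN_signN signN_projN projN_idem
  (signN_Xmx U V) projN_adj signN_adj (Xmx_adj hU hV) (ler0n _ 32)
  (Xmx_norm nU nV) y0 yt).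
Qed.

Lemma Rmx_mxnorm2_le : mxnorm2 (Rmx U V z) ^+ 2 <=
  2 * (3 * N)%:R + 2 * (1 + 32) ^+ 2 * (complex.Im (\tr (Rmx U V z)) / complex.Im z).
Proof.
rewrite /Rmx pencilE; exact: (resolvent_mxnorm2_le projN_signN signN_projN projN_idem
  (signN_Xmx U V) projN_adj signN_adj (Xmx_adj hU hV) (ler0n _ 32)
  (Xmx_norm nU nV) y0 yt).
Qed.

End Resolvents.

Section OneIndex.
Context {N : nat} (U V : 'M[R[i]]_N).
Context (hU : U^t* = U) (hV : V^t* = V) (nU : mxnorm U <= 4) (nV : mxnorm V <= 4).
Context (z : R[i]) (y0 : 0 < complex.Im z) (tau : R) (yt : complex.Im z <= tau).
Context (i : 'I_N).

Let t0 : 0 <= tau. Proof. exact: le_trans (ltW y0) yt. Qed.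
Let B := resolvent_bound tau / complex.Im z.
Let B0 : 0 <= B.
Proof. by apply: divr_ge0; [exact: resolvent_bound_ge0|exact: ltW]. Qed.

Let D := Xmx U V - Lambda z *t 1%:M.
Let G := bfe i *m Rmx U V z *m (bfe i)^t*.

Lemma RimxE : Rimx U V z i =
  Rmx (row' i 1%:M *m U *m (row' i 1%:M)^t*) (row' i 1%:M *m V *m (row' i 1%:M)^t*) z.
Proof. by rewrite /Rimx Xmx_minor. Qed.

Lemma Rimx_le : mxnorm (Rimx U V z i) <= B.
Proof.
rewrite RimxE; exact: (Rmx_le (minor_adj i hU) (minor_adj i hV)
  (minor_norm i nU) (minor_norm i nV) y0 yt).
Qed.

Let DR : D *m Rmx U V z = 1%:M.
Proof. exact: mulmxV (denominator_unit hU hV nU nV y0). Qed.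

Let RiD : Rimx U V z i *m (bfehat i *m D *m (bfehat i)^t*) = 1%:M.
Proof.
have -> : bfehat i *m D *m (bfehat i)^t* =
    bfehat i *m Xmx U V *m (bfehat i)^t* - Lambda z *t 1%:M.
  by rewrite mulmxBr mulmxBl bfehat_tens1.
apply: mulVmx; rewrite Xmx_minor; exact: (denominator_unit (minor_adj i hU) (minor_adj i hV)
  (minor_norm i nU) (minor_norm i nV) y0).
Qed.

Let hDe : bfehat i *m D *m (bfe i)^t* = bfehat i *m Xmx U V *m (bfe i)^t*.
Proof. by rewrite mulmxBr mulmxBl bfehat_tens1_bfe subr0. Qed.

Let eDh : bfe i *m D *m (bfehat i)^t* = bfe i *m Xmx U V *m (bfehat i)^t*.
Proof. by rewrite mulmxBr mulmxBl bfe_tens1_bfehat subr0. Qed.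

Let eDe : bfe i *m D *m (bfe i)^t* =
  bfe i *m Xmx U V *m (bfe i)^t* - Lambda z *t (1%:M : 'M[R[i]]_1).
Proof. by rewrite mulmxBr mulmxBl bfe_tens1. Qed.

Lemma schur_complement :
  (bfe i *m Xmx U V *m (bfe i)^t* - Lambda z *t (1%:M : 'M[R[i]]_1)
   - bfe i *m Xmx U V *m (bfehat i)^t* *m Rimx U V z i
      *m bfehat i *m Xmx U V *m (bfe i)^t*) *m G = 1%:M.
Proof.
have := schur DR RiD (bfe_split i) (bfe_adj i) (bfehat_bfe i).
by rewrite eDe eDh hDe !mulmxA.
Qed.

(** The Schur complement formula for G_i, rewritten with the error Q_i. *)
Lemma self_consistency :
  (Lambda z + Phi (Ghat U V z i) + Qmx U V z i) *m Gmx U V z i = - 1%:M.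
Proof.
have e : Lambda z + Phi (Ghat U V z i) + Qmx U V z i =
  - ((bfe i *m Xmx U V *m (bfe i)^t* - Lambda z *t (1%:M : 'M[R[i]]_1)
   - bfe i *m Xmx U V *m (bfehat i)^t* *m Rimx U V z i
      *m bfehat i *m Xmx U V *m (bfe i)^t*) : 'M[R[i]]_3).
  rewrite tens_mx11 /Qmx.
  move: (Phi _) (bfe i *m Xmx U V *m (bfe i)^t*) (_ *m _ *m _) => a b c.
  by rewrite !opprB addrCA addrC; apply/matrixP => k l; rewrite !mxE; ring.
by rewrite e mulNmx; congr (- _); exact: schur_complement.
Qed.

Definition Gavg : 'M[R[i]]_3 := N%:R^-1 *: \sum_(j < N) Gmx U V z j.

(** Deleting one index perturbs R by a matrix of rank at most 3 whose norm is at
    most that of two resolvents; its partial trace is then small. The constant 54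
    is 9 * 3 * 2. *)
Lemma Ghat_sub_Gavg : mxnorm (Ghat U V z i - Gavg) <= N%:R^-1 * (54 * B).
Proof.
have rk := elimination_diff DR RiD (bfe_split i).
have fr : row_free (bfe i *m Rmx U V z).
  apply/row_freeP; exists (D *m (bfe i)^t*).
  by rewrite mulmxA -(mulmxA (bfe i)) (mulmx1C DR) mulmx1 bfe_adj.
have nD : mxnorm ((bfehat i)^t* *m Rimx U V z i *m bfehat i - Rmx U V z) <= 2 * B.
  apply: le_trans (mxnormB _ _) _; rewrite mulrDl mul1r; apply: lerD.
    apply: le_trans (mxnormM _ _) _.
    apply: le_trans (ler_piMr (mxnorm_ge0 _) (mxnorm_bfehat i)) _.
    apply: le_trans (mxnormM _ _) _.
    apply: le_trans (ler_piMl (mxnorm_ge0 _) _) Rimx_le.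
    exact: le_trans (mxnorm_adj _) (mxnorm_bfehat i).
  exact: (Rmx_le hU hV nU nV y0 yt).
have -> : Ghat U V z i - Gavg = N%:R^-1 *: \sum_(j < N)
   (bfe j *m ((bfehat i)^t* *m Rimx U V z i *m bfehat i - Rmx U V z) *m (bfe j)^t*).
  rewrite -scalerBr -sumrB; congr (_ *: _); apply: eq_bigr => j _.
  by rewrite mulmxBr mulmxBl !mulmxA.
apply: le_trans (mxnormZ _ _) _.
rewrite cabsV; have -> : cabs (N%:R : R[i]) = N%:R.
  by rewrite -(rmorph_nat (real_complex R)) cabs_real ger0_norm.
rewrite ler_wpM2l ?invr_ge0//; have -> : 54 * B = 9 * (6 * B) by ring.
apply: mxnorm_partial_trace => W W1; rewrite rk.
apply: le_trans (trace_rank_le _ _ fr) _; rewrite -rk.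
have -> : 6 * B = (3 * 1)%:R * (1 * (2 * B)) by rewrite muln1; ring.
rewrite ler_wpM2l//; exact: ler_pM.
Qed.

(** The trace of R_i is N times that of Ghat_i; the constant 6534 is
    2 * 33^2 * 3. *)
Lemma Rimx_mxnorm2_le : (0 < N)%N -> mxnorm2 (Rimx U V z i) ^+ 2 / N%:R <=
  6 + 6534 * (mxnorm (Ghat U V z i) / complex.Im z).
Proof.
move=> N0; have Np : 0 < N%:R :> R by rewrite ltr0n.
have tE : \tr (Rimx U V z i) = N%:R * \tr (Ghat U V z i).
  rewrite /Ghat linearZ/= mulrA mulfV ?mul1r; last first.
    by rewrite pnatr_eq0 -lt0n.
  have -> : \tr (Rimx U V z i) = \tr ((bfehat i)^t* *m Rimx U V z i *m bfehat i).
    by rewrite mxtrace_mulC mulmxA bfehat_adj mul1mx.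
  rewrite -trace_partial_trace; congr (\tr _); apply: eq_bigr => j _.
  by rewrite !mulmxA.
have h : mxnorm2 (Rimx U V z i) ^+ 2 <= 2 * (3 * N.-1)%:R +
   2 * (1 + 32) ^+ 2 * (complex.Im (\tr (Rimx U V z i)) / complex.Im z).
  rewrite RimxE; exact: (Rmx_mxnorm2_le (minor_adj i hU) (minor_adj i hV)
  (minor_norm i nU) (minor_norm i nV) y0 yt).
have hI : complex.Im (\tr (Rimx U V z i)) <= N%:R * (3 * mxnorm (Ghat U V z i)).
  apply: le_trans (ler_norm _) _; apply: le_trans (Im_le_cabs _) _.
  rewrite tE cabsM; have -> : cabs (N%:R : R[i]) = N%:R.
    by rewrite -(rmorph_nat (real_complex R)) cabs_real ger0_norm.
  by rewrite ler_wpM2l//; exact: mxnorm_trace.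
rewrite natrM in h; apply: trace_budget Np y0 _ h hI.
by rewrite ler_nat leq_pred.
Qed.

End OneIndex.
End SchurComplement.

(** * The Stieltjes transform and its cubic equation *)

Section StieltjesTransform.
Context {R : realType} (mu : probability (measurableTypeR R) R).
Implicit Types (z : R[i]) (f g : R -> R).

Lemma integrable_of_bounded f (b : R) :
  measurable_fun setT (f : measurableTypeR R -> R) -> (forall t, `|f t| <= b) ->
  mu.-integrable setT (EFin \o f).
Proof.
move=> mf hb; apply: measurable_bounded_integrable => //.
  by rewrite (le_lt_trans (probability_le1 _ _))// ltry.
exists b; split; first exact: num_real.
by move=> x bx t _; exact: le_trans (hb t) (ltW bx).
Qed.

Lemma Rintegral_const (b : R) : (\int[mu]_t b : R) = b.
Proof. rewrite Rintegral_cst//.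
have e : fine (mu setT) = 1 by rewrite probability_setT.
by transitivity (b * 1); [congr (_ * _)|rewrite mulr1]. Qed.

Lemma Rintegral_le_bound f (b : R) :
  measurable_fun setT (f : measurableTypeR R -> R) -> (forall t, `|f t| <= b) ->
  `|\int[mu]_t f t| <= b.
Proof.
move=> mf hb; have hi := integrable_of_bounded mf hb.
apply: le_trans (le_normr_Rintegral _ hi) _ => //.
rewrite -[leRHS]Rintegral_const; apply: le_Rintegral => //.
- apply: (@integrable_of_bounded _ b); last by move=> t; rewrite normr_id.
  by apply: measurableT_comp.
- apply: (@integrable_of_bounded _ `|b|); [exact: measurable_cst|by []].
Qed.

Lemma Rintegral_dist_bound f g (b bf bg : R) :
  measurable_fun setT (f : measurableTypeR R -> R) ->
  measurable_fun setT (g : measurableTypeR R -> R) ->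
  (forall t, `|f t| <= bf) -> (forall t, `|g t| <= bg) ->
  (forall t, `|f t - g t| <= b) ->
  `|\int[mu]_t f t - \int[mu]_t g t| <= b.
Proof.
move=> mf mg hf hg hb; rewrite -RintegralB//; last 2 first.
- exact: integrable_of_bounded mf hf.
- exact: integrable_of_bounded mg hg.
by apply: Rintegral_le_bound => //; exact: measurable_realfun.measurable_funB.
Qed.

Definition cauchy_kernel z (t : R) : R[i] := (t%:C - z)^-1.

Lemma cauchy_kernelE z t : 0 < complex.Im z -> let d := (t - complex.Re z) ^+ 2 + complex.Im z ^+ 2 in
  0 < d /\ cauchy_kernel z t = ((t - complex.Re z) / d) +i* (complex.Im z / d).
Proof.
case: z => x y /= y0; split.
  by rewrite ltr_wpDl ?sqr_ge0// exprn_gt0.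
rewrite /cauchy_kernel /GRing.inv/=; congr (_ +i* _).
  by rewrite sub0r sqrrN.
by rewrite sub0r sqrrN mulNr opprK.
Qed.

Lemma cauchy_kernel_le z t : 0 < complex.Im z ->
  cabs (cauchy_kernel z t) <= (complex.Im z)^-1.
Proof.
move=> y0; rewrite /cauchy_kernel cabsV.
have h : complex.Im z <= cabs (t%:C - z).
  apply: le_trans (Im_le_cabs _); apply: le_trans (ler_norm _) _.
  by case: z y0 => x y /= y0; rewrite sub0r normrN.
by rewrite lef_pV2// ?posrE//; exact: lt_le_trans h.
Qed.

Lemma continuous_denominator z :
  continuous (fun t : R => (t - complex.Re z) ^+ 2 + complex.Im z ^+ 2).
Proof.
have -> : (fun t : R => (t - complex.Re z) ^+ 2 + complex.Im z ^+ 2) =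
    (fun t => (t - complex.Re z) * (t - complex.Re z) + complex.Im z ^+ 2).
  by apply/funext => t; rewrite expr2.
move=> t; apply: cvgD; last exact: cvg_cst.
by apply: cvgM; apply: cvgB; [exact: cvg_id|exact: cvg_cst|exact: cvg_id|exact: cvg_cst].
Qed.

Lemma measurable_Re_kernel z : 0 < complex.Im z ->
  measurable_fun setT ((fun t => complex.Re (cauchy_kernel z t)) : measurableTypeR R -> R).
Proof.
move=> y0; apply: measurable_realfun.continuous_measurable_fun.
have -> : (fun t => complex.Re (cauchy_kernel z t)) = (fun t : R =>
    (t - complex.Re z) / ((t - complex.Re z) ^+ 2 + complex.Im z ^+ 2)).
  by apply/funext => t; have [_ ->] := cauchy_kernelE t y0.
move=> t; apply: cvgM.
  by apply: cvgB; [exact: cvg_id|exact: cvg_cst].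
apply: cvgV; last exact: continuous_denominator.
by apply: lt0r_neq0; have [] := cauchy_kernelE t y0.
Qed.

Lemma measurable_Im_kernel z : 0 < complex.Im z ->
  measurable_fun setT ((fun t => complex.Im (cauchy_kernel z t)) : measurableTypeR R -> R).
Proof.
move=> y0; apply: measurable_realfun.continuous_measurable_fun.
have -> : (fun t => complex.Im (cauchy_kernel z t)) = (fun t : R =>
    complex.Im z / ((t - complex.Re z) ^+ 2 + complex.Im z ^+ 2)).
  by apply/funext => t; have [_ ->] := cauchy_kernelE t y0.
move=> t; apply: cvgM; first exact: cvg_cst.
apply: cvgV; last exact: continuous_denominator.
by apply: lt0r_neq0; have [] := cauchy_kernelE t y0.
Qed.

Lemma stieltjes_Im_ge0 z : 0 < complex.Im z -> 0 <= complex.Im (stieltjes mu z).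
Proof.
move=> y0; apply: Rintegral_ge0 => t _.
have [d0] := cauchy_kernelE t y0; rewrite /cauchy_kernel => ->.
by rewrite divr_ge0 ?ltW.
Qed.

Lemma stieltjes_le z : 0 < complex.Im z -> cabs (stieltjes mu z) <= 2 / complex.Im z.
Proof.
move=> y0; apply: le_trans (cabs_le_ReIm _) _.
have -> : 2 / complex.Im z = (complex.Im z)^-1 + (complex.Im z)^-1 by ring.
apply: lerD.
  apply: Rintegral_le_bound; first exact: measurable_Re_kernel.
  by move=> t; apply: le_trans (Re_le_cabs _) _; exact: cauchy_kernel_le.
apply: Rintegral_le_bound; first exact: measurable_Im_kernel.
by move=> t; apply: le_trans (Im_le_cabs _) _; exact: cauchy_kernel_le.
Qed.

Lemma stieltjes_lipschitz z z' : 0 < complex.Im z -> 0 < complex.Im z' ->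
  cabs (stieltjes mu z - stieltjes mu z') <=
  2 * (cabs (z - z') / (complex.Im z * complex.Im z')).
Proof.
move=> y0 y0'; set b := cabs _ / _.
have hk t : cabs (cauchy_kernel z t - cauchy_kernel z' t) <= b.
  have nz w : 0 < complex.Im w -> t%:C - w != 0.
    move=> w0; rewrite -invr_eq0 -/(cauchy_kernel w t).
    have [d0 ->] := cauchy_kernelE t w0; rewrite eq_complex/= negb_and.
    by apply/orP; right; apply: lt0r_neq0; exact: divr_gt0.
  have -> : cauchy_kernel z t - cauchy_kernel z' t =
      (z - z') * (cauchy_kernel z t * cauchy_kernel z' t).
    by rewrite /cauchy_kernel; field; rewrite !nz.
  rewrite cabsM /b invfM ler_wpM2l// cabsM; apply: ler_pM => //; exact: cauchy_kernel_le.
apply: le_trans (cabs_le_ReIm _) _.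
have -> : 2 * b = b + b by ring.
rewrite cReD cReN cImD cImN; apply: lerD.
  apply: (Rintegral_dist_bound (measurable_Re_kernel y0) (measurable_Re_kernel y0')
    (bf := (complex.Im z)^-1) (bg := (complex.Im z')^-1)) => t.
  - by apply: le_trans (Re_le_cabs _) _; exact: cauchy_kernel_le.
  - by apply: le_trans (Re_le_cabs _) _; exact: cauchy_kernel_le.
  - rewrite -cReN -cReD; exact: le_trans (Re_le_cabs _) (hk t).
apply: (Rintegral_dist_bound (measurable_Im_kernel y0) (measurable_Im_kernel y0')
  (bf := (complex.Im z)^-1) (bg := (complex.Im z')^-1)) => t.
- by apply: le_trans (Im_le_cabs _) _; exact: cauchy_kernel_le.
- by apply: le_trans (Im_le_cabs _) _; exact: cauchy_kernel_le.
- rewrite -cImN -cImD; exact: le_trans (Im_le_cabs _) (hk t).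
Qed.

End StieltjesTransform.

Section Cubic.
Context {R : realType} (z m : R[i]).
Context (y0 : 0 < complex.Im z) (m0 : 0 <= complex.Im m).
Context (cubic : z * m ^+ 3 - m ^+ 2 - z * m - 1 = 0).

(** Solving the cubic for z as (m^2 + 1) / (m^3 - m), the sign of Im z forces m
    into the upper half of the unit disc. *)
Lemma cubic_half_disc : 0 < complex.Im m /\ cabs m < 1.
Proof.
set w := m ^+ 3 - m.
have zw : z * w = m ^+ 2 + 1.
  by apply/eqP; rewrite -subr_eq0 -[X in _ == X]cubic /w; apply/eqP; ring.
have w0 : w != 0.
  apply/eqP => we; move: zw; rewrite we mulr0 => /esym/eqP.
  rewrite addr_eq0 => /eqP m2.
  have m3 : m * (- 2) = 0 by rewrite -[RHS]we /w exprS m2; ring.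
  have me : m = 0 by move/eqP: m3; rewrite mulf_eq0 oppr_eq0 pnatr_eq0 orbF => /eqP.
  by move/eqP: m2; rewrite me expr0n/= eq_sym oppr_eq0 oner_eq0.
have h : complex.Im ((m ^+ 2 + 1) * conjc w) = complex.Im z * cabs w ^+ 2.
  rewrite -zw -mulrA mulJC cImM mulr0 add0r.
  by [].
have pos : 0 < complex.Im ((m ^+ 2 + 1) * conjc w).
  by rewrite h mulr_gt0// exprn_gt0// cabs_gt0.
have -> : (cabs m < 1) = (cabs m ^+ 2 < 1) by rewrite expr_lt1.
rewrite sqr_cabs; move: pos m0; rewrite /w; case: (m) => X Y /=.
move=> pos Y0.
have {}pos : 0 < Y * (1 + Y ^+ 2 - (X ^+ 2 + Y ^+ 2) ^+ 2 - (X ^+ 2 + Y ^+ 2) - 3 * X ^+ 2).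
  apply: (lt_le_trans pos); rewrite le_eqVlt; apply/orP; left; apply/eqP.
  by rewrite !exprS expr0 /=; ring.
have Yp : 0 < Y by rewrite lt0r Y0 andbT; apply/eqP => Ye; move: pos; rewrite Ye mul0r ltxx.
split=> //; move: pos; rewrite pmulr_rgt0// => pos.
rewrite ltNge; apply/negP => s1.
have X2 := sqr_ge0 X; have Y2 := sqr_ge0 Y.
have : X ^+ 2 + Y ^+ 2 <= (X ^+ 2 + Y ^+ 2) ^+ 2 by rewrite expr2 ler_peMl// addr_ge0.
by lra.
Qed.

Lemma cubic_mul : z * m * (m ^+ 2 - 1) = m ^+ 2 + 1.
Proof. by apply/eqP; rewrite -subr_eq0 -[X in _ == X]cubic; apply/eqP; ring. Qed.

(** Since z m (m^2 - 1) = m^2 + 1 and |m| < 1, the numbers m^2 + 1 and m^2 - 1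
    cannot be small together. *)
Lemma cubic_gap : 2 <= cabs (m ^+ 2 - 1) * (1 + cabs z).
Proof.
have [_ m1] := cubic_half_disc.
have h1 : 2 <= cabs (m ^+ 2 + 1) + cabs (m ^+ 2 - 1).
  have e : (2 : R) = cabs ((m ^+ 2 + 1) - (m ^+ 2 - 1)).
    have -> : m ^+ 2 + 1 - (m ^+ 2 - 1) = (2 : R)%:C by rewrite rmorph_nat; ring.
    by rewrite cabs_real ger0_norm.
  by rewrite {1}e; exact: cabsB.
apply: le_trans h1 _; rewrite mulrDr mulr1 addrC lerD2l -cubic_mul cabsM mulrC.
by rewrite ler_wpM2l// cabsM ler_piMr// ltW.
Qed.

Lemma cubic_sub1 : (1 + cabs z)^-1 <= cabs (m - 1).
Proof.
have [_ m1] := cubic_half_disc; have zp : 0 < 1 + cabs z by rewrite ltr_pwDl.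
rewrite -div1r ler_pdivrMr//.
have h : cabs (m ^+ 2 - 1) <= cabs (m - 1) * 2.
  have -> : m ^+ 2 - 1 = (m - 1) * (m + 1) by ring.
  rewrite cabsM ler_wpM2l//; apply: le_trans (cabsD _ _) _; rewrite cabs1.
  by rewrite [leRHS](_ : _ = 1 + 1)// lerD2r ltW.
have := le_trans cubic_gap (ler_wpM2r (ltW zp) h); move: (cabs (m - 1)) => a; nra.
Qed.

Lemma cubic_add1 : (1 + cabs z)^-1 <= cabs (m + 1).
Proof.
have [_ m1] := cubic_half_disc; have zp : 0 < 1 + cabs z by rewrite ltr_pwDl.
rewrite -div1r ler_pdivrMr//.
have h : cabs (m ^+ 2 - 1) <= cabs (m + 1) * 2.
  have -> : m ^+ 2 - 1 = (m + 1) * (m - 1) by ring.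
  rewrite cabsM ler_wpM2l//; apply: le_trans (cabsB _ _) _; rewrite cabs1.
  by rewrite [leRHS](_ : _ = 1 + 1)// lerD2r ltW.
have := le_trans cubic_gap (ler_wpM2r (ltW zp) h); move: (cabs (m + 1)) => a; nra.
Qed.

Lemma cubic_neq0 : [/\ m != 0, m - 1 != 0 & m + 1 != 0].
Proof.
have zp : 0 < (1 + cabs z)^-1 by rewrite invr_gt0 ltr_pwDl.
split.
- apply/eqP => me; have [] := cubic_half_disc; by rewrite me ltxx.
- by rewrite -cabs_gt0; exact: lt_le_trans zp cubic_sub1.
- by rewrite -cabs_gt0; exact: lt_le_trans zp cubic_add1.
Qed.

(** The first polynomial is (m^2 + 2)^2 - 5; its real zeros and the zeros outside
    the unit disc are excluded. *)
Lemma cubic_nondegenerate : [/\ m ^+ 4 + m ^+ 2 *+ 4 - 1 != 0, m *+ 2 - 1 != 0 & m *+ 2 + 1 != 0].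
Proof.
have [mp m1] := cubic_half_disc; move: mp m1.
have -> : (cabs m < 1) = (cabs m ^+ 2 < 1) by rewrite expr_lt1.
rewrite sqr_cabs; case: (m) => X Y /= Yp s1; split; apply/eqP.
- have -> : (X +i* Y) ^+ 4 + (X +i* Y) ^+ 2 *+ 4 - 1 =
    ((X ^+ 2 - Y ^+ 2 + 2) ^+ 2 - (2 * X * Y) ^+ 2 - 5) +i*
    (2 * (X ^+ 2 - Y ^+ 2 + 2) * (2 * X * Y)).
    rewrite !exprS expr0 !mulrS mulr0n; apply/eqP; rewrite eq_complex/=.
    by apply/andP; split; apply/eqP; ring.
  case=> h1 h2; have X2 := sqr_ge0 X; have Y2 := sqr_ge0 Y.
  have X0 : X = 0.
    move/eqP: h2; rewrite !mulf_eq0 pnatr_eq0/= (gt_eqF Yp) orbF.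
    case/orP => [/eqP h|/eqP//]; exfalso; by lra.
  by move: h1; rewrite X0; nra.
- rewrite mulr2n => /(congr1 (@complex.Im R))/=; lra.
- rewrite mulr2n => /(congr1 (@complex.Im R))/=; lra.
Qed.

End Cubic.

(** * Stability of the self-consistency equation *)

Section OperatorsOn3x3.
Context {R : realType}.

Lemma Phi_is_linear : linear (@Phi R).
Proof.
have h (P : 'M[R[i]]_3) : linear (fun A => P *m A *m P).
  by move=> a x y; exact: (linearP (mulmxr P \o mulmx P)).
by move=> a x y; rewrite /Phi !h scalerDr addrACA.
Qed.
HB.instance Definition _ := GRing.isLinear.Build R[i] 'M[R[i]]_3 'M[R[i]]_3 _
  (@Phi R) Phi_is_linear.

(** The linear part at M of the self-consistency equation. *)
Definition stability_map (M x : 'M[R[i]]_3) : 'M[R[i]]_3 :=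
  invmx M *m x - Phi x *m M.

Lemma stability_map_is_linear M : linear (stability_map M).
Proof.
have h1 : linear (mulmx (invmx M)) by move=> a x y; exact: linearP.
have h2 : linear (fun x => Phi x *m M).
  by move=> a x y; exact: (linearP (mulmxr M \o @Phi R)).
by move=> a x y; rewrite /stability_map h1 h2 scalerBr opprD addrACA.
Qed.
HB.instance Definition _ M := GRing.isLinear.Build R[i] 'M[R[i]]_3 'M[R[i]]_3 _
  (stability_map M) (stability_map_is_linear M).

(** A linear map of matrices is bounded, so that the supremum defining opnorm is
    an upper bound. *)
Lemma opnormP (T : {linear 'M[R[i]]_3 -> 'M[R[i]]_3}) (x : 'M[R[i]]_3) :
  mxnorm (T x) <= opnorm T * mxnorm x.
Proof.
pose b := \sum_i \sum_j mxnorm (T (delta_mx i j)).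
have hb y : mxnorm (T y) <= b * mxnorm y.
  rewrite {1}[y]matrix_sum_delta raddf_sum/=; apply: le_trans (mxnorm_sum _ _ _) _.
  rewrite mulr_suml; apply: ler_sum => i _.
  rewrite raddf_sum/=; apply: le_trans (mxnorm_sum _ _ _) _.
  rewrite mulr_suml; apply: ler_sum => j _.
  rewrite linearZ/=; apply: le_trans (mxnormZ _ _) _; rewrite mulrC.
  by apply: ler_wpM2l; [exact: mxnorm_ge0|exact: cabs_le_mxnorm].
have b0 : 0 <= b by apply: sumr_ge0 => i _; apply: sumr_ge0 => j _; exact: mxnorm_ge0.
have ub y : mxnorm y <= 1 -> mxnorm (T y) <= opnorm T.
  move=> y1; apply: ub_le_sup; last by exists y.
  exists b => _ [w w1 <-]; apply: le_trans (hb w) _; exact: ler_piMr.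
have [x0|x0] := eqVneq (mxnorm x) 0.
  by apply: le_trans (hb x) _; rewrite x0 !mulr0.
have xp : 0 < mxnorm x by rewrite lt0r x0 mxnorm_ge0.
have c0 : cabs ((mxnorm x)%:C : R[i]) = mxnorm x by rewrite cabs_real ger0_norm.
have xE : x = (mxnorm x)%:C *: ((mxnorm x)%:C^-1 *: x).
  by rewrite scalerA mulfV ?scale1r// -cabs_eq0 c0.
rewrite {1}xE linearZ/=; apply: le_trans (mxnormZ _ _) _; rewrite c0 mulrC.
rewrite ler_wpM2r//; apply: ub; apply: le_trans (mxnormZ _ _) _.
by rewrite cabsV c0 mulVf.
Qed.

Lemma PhiE (x : 'M[R[i]]_3) : [/\ [/\ Phi x 0 0 = x 1 1 + x 2 2, Phi x 0 1 = x 1 0 & Phi x 0 2 = x 2 0],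
  [/\ Phi x 1 0 = x 0 1, Phi x 1 1 = x 0 0 & Phi x 1 2 = 0] &
  [/\ Phi x 2 0 = x 0 2, Phi x 2 1 = 0 & Phi x 2 2 = x 0 0]].
Proof.
rewrite /Phi /e12 /e21 /e13 /e31.
by split; split; rewrite ?(mxE, sum3)/= ?(mxE, sum3)/= ?(mxE, sum3)/=
  ?(mulr0, mul0r, mulr1, mul1r, addr0, add0r) //; exact: addrC.
Qed.

Lemma diag3E (a b c : R[i]) : [/\ diag3 a b c 0 0 = a, diag3 a b c 1 1 = b & diag3 a b c 2 2 = c].
Proof. by rewrite /diag3; split; rewrite !mxE. Qed.

Lemma mxnorm_diag3 (a b c : R[i]) : mxnorm (diag3 a b c) <= cabs a + cabs b + cabs c.
Proof.
apply: le_trans (mxnorm_le_sum _) _; rewrite /diag3.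
by rewrite !big_ord_recl !big_ord0 !mxE /= !mulr0n !mulr1n !cabs0 !(addr0, add0r) addrA.
Qed.

Lemma diag3_mul (a b c a' b' c' : R[i]) :
  diag3 a b c *m diag3 a' b' c' = diag3 (a * a') (b * b') (c * c').
Proof.
apply/matrixP; elim/ord3_ind; elim/ord3_ind;
by rewrite /diag3 ?(mxE, sum3)/= ?(mxE, sum3)/=; ring.
Qed.

Lemma diag3_add (a b c a' b' c' : R[i]) :
  diag3 a b c + diag3 a' b' c' = diag3 (a + a') (b + b') (c + c').
Proof.
by apply/matrixP; elim/ord3_ind; elim/ord3_ind; rewrite /diag3 !mxE /=; ring.
Qed.

Lemma diag3_opp (a b c : R[i]) : - diag3 a b c = diag3 (- a) (- b) (- c).
Proof.
by apply/matrixP; elim/ord3_ind; elim/ord3_ind; rewrite /diag3 !mxE /=; ring.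
Qed.

Lemma diag3_1 : diag3 1 1 1 = 1%:M :> 'M[R[i]]_3.
Proof.
by apply/matrixP; elim/ord3_ind; elim/ord3_ind; rewrite /diag3 !mxE /=.
Qed.

Lemma Phi_diag3 (a b c : R[i]) : Phi (diag3 a b c) = diag3 (b + c) a a.
Proof.
have [[h1 h2 h3] [h4 h5 h6] [h7 h8 h9]] := PhiE (diag3 a b c).
apply/matrixP; elim/ord3_ind; elim/ord3_ind;
by rewrite ?(h1,h2,h3,h4,h5,h6,h7,h8,h9) /diag3 !mxE.
Qed.

Section AtCubicRoot.
Context (z m : R[i]) (y0 : 0 < complex.Im z) (m0 : 0 <= complex.Im m).
Context (cubic : z * m ^+ 3 - m ^+ 2 - z * m - 1 = 0).

Let M := diag3 m (- (m - 1)^-1) (- (m + 1)^-1).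

Lemma M_equation : (Lambda z + Phi M) *m M = - 1%:M.
Proof.
have [n0 n1 n2] := cubic_neq0 y0 m0 cubic.
rewrite /M Phi_diag3 /Lambda diag3_add diag3_mul -diag3_1 diag3_opp; congr diag3.
- apply/eqP; rewrite -subr_eq0; apply/eqP.
  have -> : (z + (- (m - 1)^-1 - (m + 1)^-1)) * m - (-1) =
     (z * m ^+ 3 - m ^+ 2 - z * m - 1) / ((m - 1) * (m + 1)).
    by field; rewrite n1 n2.
  by rewrite cubic mul0r.
- by field.
- by field.
Qed.

Lemma M_unit : M \in unitmx.
Proof.
have h := M_equation; have : (- (Lambda z + Phi M)) *m M = 1%:M.
  by rewrite mulNmx h opprK.
by case/mulmx1_unit.
Qed.

(** In the kernel x = M Phi(x) M; entrywise this decouples into systems for x 0 0,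
    for (x 0 1, x 1 0) and for (x 0 2, x 2 0), whose determinants are, up to nonzero
    factors, the three quantities of [cubic_nondegenerate]; the other entries are 0
    or multiples of x 0 0. *)
Lemma stability_map_injective : injective (stability_map M).
Proof.
apply: raddf_inj => x hx.
have [n0 n1 n2] := cubic_neq0 y0 m0 cubic.
have [d1 d2 d3] := cubic_nondegenerate y0 m0 cubic.
have xE : x = M *m Phi x *m M.
  have /eqP := hx; rewrite /stability_map subr_eq0 => /eqP h.
  by rewrite -mulmxA -h mulmxA mulmxV ?M_unit// mul1mx.
have ent (i j : 'I_3) : x i j = M i i * Phi x i j * M j j.
  by rewrite {1}xE /M /diag3 mul_mx_diag mul_diag_mx !mxE eqxx !mulr1n eqxx mulr1n.
have [M0 M1 M2] := diag3E m (- (m - 1)^-1) (- (m + 1)^-1); rewrite -/M in M0 M1 M2.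
have [[h1 h2 h3] [h4 h5 h6] [h7 h8 h9]] := PhiE x.
have x00 : x 0 0 = 0.
  have e : x 0 0 * (m ^+ 4 + m ^+ 2 *+ 4 - 1) = 0.
    have e0 := ent 0 0; have e1 := ent 1 1; have e2 := ent 2 2.
    rewrite h1 M0 in e0; rewrite h5 M1 in e1; rewrite h9 M2 in e2.
    rewrite e1 e2 in e0.
    have : x 0 0 - m * (- (m - 1)^-1 * x 0 0 * - (m - 1)^-1 + - (m + 1)^-1 * x 0 0 * - (m + 1)^-1) * m = 0.
      by apply/eqP; rewrite subr_eq0; apply/eqP.
    move: (x 0 0) => t ht.
    have -> : t * (m ^+ 4 + m ^+ 2 *+ 4 - 1) =
      - ((m - 1) ^+ 2 * (m + 1) ^+ 2) * (t - m * (- (m - 1)^-1 * t * - (m - 1)^-1 + - (m + 1)^-1 * t * - (m + 1)^-1) * m).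
      by field; rewrite n1 n2.
    by rewrite ht mulr0.
  by move/eqP: e; rewrite mulf_eq0 (negPf d1) orbF => /eqP.
have pair (s t p : R[i]) : p != 0 -> p ^+ 2 - m ^+ 2 != 0 ->
    s = m * t * - p^-1 -> t = - p^-1 * s * m -> s = 0 /\ t = 0.
  move=> p0 pm hs ht.
  suff s0 : s = 0 by split=> //; rewrite ht s0 mulr0 mul0r.
  have : (p ^+ 2 - m ^+ 2) * s = 0.
    by rewrite mulrBl {1}hs {1}ht; field.
  by move/eqP; rewrite mulf_eq0 (negPf pm) => /eqP.
have g1 : (m - 1) ^+ 2 - m ^+ 2 != 0.
  have -> : (m - 1) ^+ 2 - m ^+ 2 = - (m *+ 2 - 1) by rewrite mulr2n; ring.
  by rewrite oppr_eq0.
have g2 : (m + 1) ^+ 2 - m ^+ 2 != 0.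
  by have -> : (m + 1) ^+ 2 - m ^+ 2 = m *+ 2 + 1 by rewrite mulr2n; ring.
have e01 := ent 0 1; have e10 := ent 1 0; rewrite h2 M0 M1 in e01.
rewrite h4 M0 M1 in e10; have [x01 x10] := pair _ _ _ n1 g1 e01 e10.
have e02 := ent 0 2; have e20 := ent 2 0; rewrite h3 M0 M2 in e02.
rewrite h7 M0 M2 in e20; have [x02 x20] := pair _ _ _ n2 g2 e02 e20.
apply/matrixP; elim/ord3_ind; elim/ord3_ind; rewrite [RHS]mxE //.
- by rewrite ent h5 x00 mulr0 mul0r.
- by rewrite ent h6 mulr0 mul0r.
- by rewrite ent h8 mulr0 mul0r.
- by rewrite ent h9 x00 mulr0 mul0r.
Qed.

Lemma mxnorm_M : mxnorm M <= 3 * (1 + cabs z).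
Proof.
have [n0 n1 n2] := cubic_neq0 y0 m0 cubic; have [_ m1] := cubic_half_disc y0 m0 cubic.
have zp : 0 < 1 + cabs z by rewrite ltr_pwDl.
have inv_le (p : R[i]) : (1 + cabs z)^-1 <= cabs p -> cabs (- p^-1) <= 1 + cabs z.
  move=> h; rewrite cabsN cabsV -[leRHS]invrK lef_pV2 ?posrE ?invr_gt0//.
  by apply: lt_le_trans h; rewrite invr_gt0.
apply: le_trans (mxnorm_diag3 _ _ _) _.
have h1 := inv_le _ (cubic_sub1 y0 m0 cubic); have h2 := inv_le _ (cubic_add1 y0 m0 cubic).
have z0 := cabs_ge0 z; lra.
Qed.

End AtCubicRoot.

Lemma diag3_sub_le (m m' : R[i]) (b : R) : 0 <= b -> 
  m - 1 != 0 -> m + 1 != 0 -> m' - 1 != 0 -> m' + 1 != 0 ->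
  cabs (m - 1)^-1 <= b -> cabs (m + 1)^-1 <= b ->
  cabs (m' - 1)^-1 <= b -> cabs (m' + 1)^-1 <= b ->
  mxnorm (diag3 m (- (m - 1)^-1) (- (m + 1)^-1) -
          diag3 m' (- (m' - 1)^-1) (- (m' + 1)^-1)) <=
  (1 + 2 * b ^+ 2) * cabs (m - m').
Proof.
move=> b0 n1 n2 n1' n2' h1 h2 h1' h2'; rewrite diag3_opp diag3_add.
apply: le_trans (mxnorm_diag3 _ _ _) _.
have -> : - (m - 1)^-1 - - (m' - 1)^-1 = (m - 1)^-1 * (m' - 1)^-1 * (m - m').
  by field; rewrite n1 n1'.
have -> : - (m + 1)^-1 - - (m' + 1)^-1 = (m + 1)^-1 * (m' + 1)^-1 * (m - m').
  by field; rewrite n2 n2'.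
rewrite !cabsM.
have g1 : cabs (m - 1)^-1 * cabs (m' - 1)^-1 <= b ^+ 2 by rewrite expr2; exact: ler_pM.
have g2 : cabs (m + 1)^-1 * cabs (m' + 1)^-1 <= b ^+ 2 by rewrite expr2; exact: ler_pM.
have d0 := cabs_ge0 (m - m').
have k1 := ler_wpM2r d0 g1; have k2 := ler_wpM2r d0 g2.
apply: le_trans (lerD (lerD (lexx _) k1) k2) _.
by rewrite mulrDl mul1r -addrA -mulrDl mulr2n -mulr2n mulr_natl.
Qed.

Lemma mxnorm_avg N (F : 'I_N -> 'M[R[i]]_3) (b : R) : (0 < N)%N ->
  (forall i, mxnorm (F i) <= b) -> mxnorm (N%:R^-1 *: \sum_i F i) <= b.
Proof.
move=> N0 h; apply: le_trans (mxnormZ _ _) _.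
have -> : cabs (N%:R^-1 : R[i]) = N%:R^-1.
  by rewrite cabsV -(rmorph_nat (real_complex R)) cabs_real ger0_norm.
rewrite ler_pdivrMl ?ltr0n//; apply: le_trans (mxnorm_sum _ _ _) _.
apply: le_trans (ler_sum _ (fun i _ => h i)) _.
by rewrite sumr_const card_ord mulr_natl.
Qed.

Lemma avg_const N (A : 'M[R[i]]_3) : (0 < N)%N -> N%:R^-1 *: (\sum_(j < N) A) = A.
Proof.
move=> N0; rewrite sumr_const card_ord -(scaler_nat N A) scalerA mulVf ?scale1r//.
by rewrite pnatr_eq0 -lt0n.
Qed.

(** Subtracting the equation for M from that for G_i and averaging over i gives
    L (F - M) = (quadratic term in F - M) + (average of E_i G_i) for the stability
    map L, where F is the average of the G_i. As soon as all G_i are within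
    1 / (8 k p) of M the quadratic term is absorbed, which bounds F - M, and then
    each G_i - M, linearly in the errors E_i. *)
Lemma stability (N : nat) (L M : 'M[R[i]]_3) (G Gh Q : 'I_N -> 'M[R[i]]_3)
    (kap : 'M[R[i]]_3 -> 'M[R[i]]_3) (k p w e b : R) :
  (0 < N)%N -> M \in unitmx -> (L + Phi M) *m M = - 1%:M ->
  (forall x, kap (stability_map M x) = x) ->
  (forall x, mxnorm (kap x) <= k * mxnorm x) ->
  (forall x, mxnorm (Phi x) <= p * mxnorm x) ->
  1 <= k -> 1 <= p -> 0 <= b -> mxnorm M <= b ->
  (forall i, (L + Phi (Gh i) + Q i) *m G i = - 1%:M) ->
  (forall i, mxnorm (G i - M) <= w) -> w <= 1 / (8 * k * p) ->
  let F := N%:R^-1 *: \sum_i G i in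
  (forall i, mxnorm (Q i + Phi (Gh i - F)) <= e) ->
  forall i, mxnorm (G i - M) <= 3 * b * (b + 1) ^+ 2 * (p * k) * e.
Proof.
move=> N0 uM eM kapK kapb Phib k1 p1 b0 Mb eG Gw wk F Eb i.
have k0 : 0 < k by exact: lt_le_trans k1.
have p0 : 0 < p by exact: lt_le_trans p1.
have w0 : 0 <= w by apply: le_trans (mxnorm_ge0 _) (Gw i).
have e0 : 0 <= e by apply: le_trans (mxnorm_ge0 _) (Eb i).
have wkp : w * (k * p) <= 8^-1.
  move: wk; rewrite div1r -[_ * k * p]mulrA invfM => wk.
  by rewrite -ler_pdivlMr// mulr_gt0.
have kp1 : 1 <= k * p by rewrite mulr_ege1.
have w1 : w <= 1.
  have : w * 1 <= w * (k * p) by rewrite ler_wpM2l.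
  rewrite mulr1 => h; apply: le_trans h (le_trans wkp _).
  by rewrite invf_le1// ler1n.
have Gb j : mxnorm (G j) <= b + 1.
  have -> : G j = M + (G j - M) by rewrite addrC subrK.
  apply: le_trans (mxnormD _ _) _; exact: lerD Mb (le_trans (Gw j) w1).
pose E j := Q j + Phi (Gh j - F).
have EG j : mxnorm (E j *m G j) <= e * (b + 1).
  exact: le_trans (mxnormM _ _) (ler_pM (mxnorm_ge0 _) (mxnorm_ge0 _) (Eb j) (Gb j)).
have LE : L = - invmx M - Phi M.
  have <- : (L + Phi M) *m M *m invmx M = - invmx M by rewrite eM mulNmx mul1mx.
  by rewrite mulmxK// addrK.
have key j : invmx M *m (G j - M) = Phi (F - M) *m G j + E j *m G j.
  have h := eG j; rewrite LE in h.
  rewrite mulmxBr mulVmx// -mulmxDl /E !raddfB/=.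
  apply/eqP; rewrite subr_eq addrC -subr_eq; apply/eqP.
  apply: oppr_inj; rewrite opprB -h -mulmxBl; congr (_ *m _).
  by move: (Phi F) (Phi M) (Phi (Gh j)) (Q j) (invmx M) => a1 a2 a3 a4 a5;
    apply/matrixP => x y; rewrite !mxE; ring.
set f := mxnorm (F - M).
have avgB : F - M = N%:R^-1 *: \sum_j (G j - M).
  by rewrite sumrB scalerBr avg_const.
have fb : f <= w by rewrite /f avgB; apply: mxnorm_avg.
have f0 : 0 <= f by exact: mxnorm_ge0.
have stab : stability_map M (F - M) =
    N%:R^-1 *: \sum_j (Phi (F - M) *m (G j - M) + E j *m G j).
  rewrite /stability_map {1}avgB -scalemxAr mulmx_sumr (eq_bigr _ (fun j _ => key j)).
  have -> : Phi (F - M) *m M = N%:R^-1 *: \sum_(j < N) (Phi (F - M) *m M).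
    by rewrite avg_const.
  rewrite -scalerBr -sumrB; congr (_ *: _); apply: eq_bigr => j _.
  by rewrite addrAC mulmxBr.
have fk : f <= k * (p * f * w + e * (b + 1)).
  rewrite /f -{1}[F - M]kapK stab; apply: le_trans (kapb _) _.
  rewrite ler_pM2l//; apply: mxnorm_avg => // j.
  apply: le_trans (mxnormD _ _) _; apply: lerD; last exact: EG.
  exact: le_trans (mxnormM _ _) (ler_pM (mxnorm_ge0 _) (mxnorm_ge0 _) (Phib _) (Gw j)).
have f2 : f <= 2 * (k * (e * (b + 1))).
  have : f * (w * (k * p)) <= f * 8^-1 by rewrite ler_wpM2l.
  have : 0 <= k * (e * (b + 1)) by rewrite !mulr_ge0 ?addr_ge0// ltW.
  by move: fk; move: (e * (b + 1)) => q; lra.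
have -> : G i - M = M *m (Phi (F - M) *m G i + E i *m G i).
  by rewrite -key mulmxA mulmxV// mul1mx.
have b1 : 0 <= b + 1 by rewrite addr_ge0.
have h1 : mxnorm (Phi (F - M) *m G i + E i *m G i) <= p * f * (b + 1) + e * (b + 1).
  apply: le_trans (mxnormD _ _) _; apply: lerD; last exact: EG.
  exact: le_trans (mxnormM _ _) (ler_pM (mxnorm_ge0 _) (mxnorm_ge0 _) (Phib _) (Gb i)).
apply: le_trans (mxnormM _ _) _.
apply: le_trans (ler_pM (mxnorm_ge0 _) (mxnorm_ge0 _) Mb h1) _.
have -> : 3 * b * (b + 1) ^+ 2 * (p * k) * e =
  b * (p * (2 * (k * (e * (b + 1)))) * (b + 1) + (k * p) * (b + 1) * (e * (b + 1))) by ring.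
rewrite ler_wpM2l// lerD//.
  by rewrite ler_wpM2r// ler_wpM2l// ltW.
apply: ler_peMl; first exact: mulr_ge0.
by apply: mulr_ege1 => //; rewrite lerDr.
Qed.

End OperatorsOn3x3.

(** * Control of the error terms *)

Section ErrorControl.
Context {R : realType}.

Lemma mxnormM_le k l n (P : 'M[R[i]]_(k, l)) (Q : 'M[R[i]]_(l, n)) (a b : R) :
  mxnorm P <= a -> mxnorm Q <= b -> mxnorm (P *m Q) <= a * b.
Proof.
move=> hP hQ; apply: le_trans (mxnormM _ _) _.
exact: (ler_pM (mxnorm_ge0 _) (mxnorm_ge0 _)).
Qed.

Lemma mxnormM_contr k l n (P : 'M[R[i]]_(k, l)) (Q : 'M[R[i]]_(l, n)) (a : R) :
  mxnorm P <= a -> mxnorm Q <= 1 -> mxnorm (P *m Q) <= a.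
Proof. by move=> hP hQ; rewrite -[a]mulr1; exact: mxnormM_le. Qed.

Lemma row_const_ge (t y M : R) : 0 <= t -> 0 <= M -> y <= t -> y <= 7 * t + 6534 * M.
Proof. by move=> *; lra. Qed.

Lemma row_const_sum (t y g M : R) : 0 <= t -> g <= M -> 0 < y -> y <= t ->
  6 + 6534 * (g / y) <= (7 * t + 6534 * M) / y.
Proof.
move=> t0 gM y0 yt; rewrite ler_pdivlMr// mulrDl -[6534 * _ * y]mulrA divfK ?gt_eqF//.
lra.
Qed.

Section OneMatrix.
Context {N : nat} (U V : 'M[R[i]]_N) (N2 : (2 <= N)%N).
Context (hU : U^t* = U) (hV : V^t* = V) (nU : mxnorm U <= 4) (nV : mxnorm V <= 4).
Context (tau : R) (tau8 : 8 <= tau).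
Implicit Types (z : R[i]) (i : 'I_N).

Let N0 : (0 < N)%N. Proof. exact: ltn_trans N2. Qed.
Let Np : 0 < N%:R :> R. Proof. by rewrite ltr0n. Qed.
Let sNp : 0 < Num.sqrt N%:R :> R. Proof. by rewrite sqrtr_gt0. Qed.
Let t0 : 0 <= tau. Proof. exact: le_trans (ler0n _ 8) tau8. Qed.
Let phi1 : R := bullet (opnorm (@Phi R)).

Lemma bullet_ge1 (x : R) : 1 <= bullet x.
Proof. by rewrite /bullet le_max lexx orbT. Qed.

Lemma le_bullet (x : R) : x <= bullet x.
Proof. by rewrite /bullet le_max lexx. Qed.

Lemma Phi_le x : mxnorm (Phi x) <= phi1 * mxnorm x.
Proof.
apply: le_trans (opnormP _ x) _; apply: ler_wpM2r; first exact: mxnorm_ge0.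
exact: le_bullet.
Qed.

Lemma frakKi_ge1 z i : 1 <= frakKi U V z i.
Proof. by rewrite /frakKi le_max lexx. Qed.

Lemma Qmx_le_frakKi z i : mxnorm (Qmx U V z i) <= frakKi U V z i *
  ((Num.sqrt N%:R)^-1 * Num.max 1 (mxnorm2 (Rimx U V z i) / Num.sqrt N%:R)).
Proof.
rewrite -ler_pdivrMr; first by rewrite /frakKi le_max lexx orbT.
by rewrite mulr_gt0// ?invr_gt0// lt_max ltr01.
Qed.

Lemma calR_bounds z : @calR R N tau z ->
  [/\ 0 < complex.Im z, complex.Im z <= tau, (complex.Im z)^-1 <= N%:R & cabs z <= 8 + tau].
Proof.
case=> y0 x8 /andP[yN yt]; split => //.
  by rewrite -[leRHS]invrK lef_pV2 ?posrE ?invr_gt0.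
apply: le_trans (cabs_le_ReIm _) _; apply: lerD => //.
by rewrite ger0_norm// ltW.
Qed.

Let B : R := resolvent_bound tau.
Let B0 : 0 <= B. Proof. exact: resolvent_bound_ge0. Qed.

Lemma Ghat_le z i : 0 < complex.Im z -> complex.Im z <= tau ->
  mxnorm (Ghat U V z i) <= B / complex.Im z.
Proof.
move=> y0 yt; apply: mxnorm_avg => // j.
have h1 := mxnorm_bfe (R := R) j; have h2 := mxnorm_bfehat (R := R) i.
have h1' := le_trans (mxnorm_adj _) h1; have h2' := le_trans (mxnorm_adj _) h2.
apply: (mxnormM_contr _ h1'); apply: (mxnormM_contr _ h2).
rewrite -[leRHS]mul1r; apply: mxnormM_le (Rimx_le hU hV nU nV y0 yt i).
exact: mxnormM_contr h1 h2'.
Qed.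

Lemma Qmx_le z i : 0 < complex.Im z -> complex.Im z <= tau ->
  mxnorm (Qmx U V z i) <= 32 * (B / complex.Im z) * 32 + 32 + phi1 * (B / complex.Im z).
Proof.
move=> y0 yt; have h1 := mxnorm_bfe (R := R) i; have h2 := mxnorm_bfehat (R := R) i.
have h1' := le_trans (mxnorm_adj _) h1; have h2' := le_trans (mxnorm_adj _) h2.
have hX := Xmx_norm nU nV.
have hR := Rimx_le hU hV nU nV y0 yt i.
have eX : mxnorm (bfe i *m Xmx U V) <= 32.
  by rewrite -[leRHS]mul1r; exact: mxnormM_le h1 hX.
apply: le_trans (mxnormB _ _) _; apply: lerD.
  apply: le_trans (mxnormB _ _) _; apply: lerD.
    apply: (mxnormM_contr _ h1'); apply: (mxnormM_le _ hX).
    apply: (mxnormM_contr _ h2); apply: (mxnormM_le _ hR).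
    exact: mxnormM_contr eX h2'.
  exact: mxnormM_contr eX h1'.
apply: le_trans (Phi_le _) _; apply: ler_wpM2l; first exact: le_trans (bullet_ge1 _).
exact: Ghat_le.
Qed.

(** On the region Im z >= 1 / N, so that the resolvents have norm of order N. *)
Lemma frakK_has_sup : has_sup [set frakK U V z | z in @calR R N tau].
Proof.
split.
  exists (frakK U V 'i); exists 'i => //; split => //=.
  - exact: ltr01.
  - by rewrite normr0.
  - rewrite invf_le1// ler1n N0/=; exact: le_trans (ler1n _ 8) tau8.
pose b := 32 * (B * N%:R) * 32 + 32 + phi1 * (B * N%:R).
have b0 : 0 <= b.
  have p0 : 0 <= phi1 by exact: le_trans (bullet_ge1 _).
  by rewrite /b !addr_ge0// !mulr_ge0.
exists (1 + b * Num.sqrt N%:R) => _ [z /calR_bounds[y0 yt yN _] <-].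
have h1 : 1 <= 1 + b * Num.sqrt N%:R by rewrite lerDl mulr_ge0// sqrtr_ge0.
apply: bigmax_le => // i _; rewrite /frakKi ge_max h1/=.
have hb : mxnorm (Qmx U V z i) <= b.
  apply: le_trans (Qmx_le i y0 yt) _.
  have hB : B / complex.Im z <= B * N%:R by rewrite ler_wpM2l.
  have p0 : 0 <= phi1 by exact: le_trans (bullet_ge1 _).
  rewrite /b; apply: lerD; last exact: ler_wpM2l.
  by rewrite lerD2r ler_wpM2r// ler_wpM2l.
rewrite ler_pdivrMr ?mulr_gt0 ?invr_gt0// ?lt_max ?ltr01//.
apply: le_trans hb _.
have e : b = (b * Num.sqrt N%:R) * ((Num.sqrt N%:R)^-1 * 1).
  by field; exact: lt0r_neq0.
rewrite {1}e.
apply: ler_pM.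
- by rewrite mulr_ge0// sqrtr_ge0.
- by rewrite mulr1 invr_ge0 sqrtr_ge0.
- by rewrite lerDr.
- by rewrite ler_wpM2l ?invr_ge0 ?sqrtr_ge0// le_max lexx.
Qed.

Lemma frakKi_le_supK z i : @calR R N tau z -> frakKi U V z i <= supK U V tau.
Proof.
move=> hz; apply: (@le_trans _ _ (frakK U V z)); first exact: le_bigmax.
by apply: sup_upper_bound; [exact: frakK_has_sup|exists z].
Qed.

Lemma supK_ge1 : 1 <= supK U V tau.
Proof.
have [[_ [z hz _]] _] := frakK_has_sup.
by apply: le_trans (frakKi_ge1 z (Ordinal N0)) _; exact: frakKi_le_supK.
Qed.

(** A bound on the norm of M over the region, as |z| <= 8 + t there. *)
Definition Mbound (t : R) : R := 3 * (9 + t).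
(** A bound on sqrt (Im z) max (1, |R_i|_2 / sqrt N). *)
Definition row_const (t : R) : R :=
  Num.sqrt (7 * t + 6534 * (Mbound t + 1 + 54 * resolvent_bound t)).
Definition error_const (t : R) : R :=
  row_const t + 54 * (bullet (opnorm (@Phi R)) * resolvent_bound t).

(** If F is bounded then so is Ghat_i, hence the Frobenius norm of R_i is of order
    sqrt (N / Im z), and the definition of K bounds Q_i. *)
Lemma error_le z i : @calR R N tau z -> mxnorm (Gavg U V z) <= Mbound tau + 1 ->
  mxnorm (Qmx U V z i + Phi (Ghat U V z i - Gavg U V z)) <=
    error_const tau * (supK U V tau / Num.sqrt (N%:R * complex.Im z)).
Proof.
move=> hz hF; have [y0 yt yN _] := calR_bounds hz.
set y := complex.Im z in y0 yt yN *; set K := supK U V tau.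
have K1 : 1 <= K by exact: supK_ge1.
have K0 : 0 <= K by exact: le_trans K1.
have Ny : 1 <= N%:R * y by rewrite -ler_pdivrMr// mul1r.
have Nyp : 0 < N%:R * y by exact: lt_le_trans Ny.
set s := Num.sqrt (N%:R * y); have sp : 0 < s by rewrite sqrtr_gt0.
have s1 : 1 <= s by rewrite -[leLHS]sqrtr1 ler_sqrt// ltW.
have s2 : s ^+ 2 = N%:R * y by rewrite sqr_sqrtr// ltW.
have sy : Num.sqrt y ^+ 2 = y by rewrite sqr_sqrtr// ltW.
have syp : 0 < Num.sqrt y by rewrite sqrtr_gt0.
have sE : s = Num.sqrt N%:R * Num.sqrt y by rewrite -sqrtrM// ltW.
have p1 : 1 <= phi1 by exact: bullet_ge1.
have dist : mxnorm (Ghat U V z i - Gavg U V z) <= 54 * B / s ^+ 2.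
  have := Ghat_sub_Gavg hU hV nU nV y0 yt i; rewrite s2.
  have -> : 54 * B / (N%:R * y) = N%:R^-1 * (54 * (B / y)).
    by field; rewrite !lt0r_neq0.
  exact.
have dist1 : mxnorm (Ghat U V z i - Gavg U V z) <= 54 * B.
  apply: le_trans dist _; rewrite ler_pdivrMr ?exprn_gt0// ler_peMr ?mulr_ge0//.
  by rewrite exprn_ege1.
have hG : mxnorm (Ghat U V z i) <= Mbound tau + 1 + 54 * B.
  have -> : Ghat U V z i = Gavg U V z + (Ghat U V z i - Gavg U V z).
    by rewrite addrC subrK.
  apply: le_trans (mxnormD _ _) _; exact: lerD.
have M0 : 0 <= Mbound tau + 1 + 54 * B.
  exact: le_trans (mxnorm_ge0 _) hG.
have rc0 : 0 <= 7 * tau + 6534 * (Mbound tau + 1 + 54 * B).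
  by apply: addr_ge0; apply: mulr_ge0; [exact: ler0n|exact: t0|exact: ler0n|exact: M0].
have rowb : Num.max 1 (mxnorm2 (Rimx U V z i) / Num.sqrt N%:R) <= row_const tau / Num.sqrt y.
  rewrite ge_max; apply/andP; split.
    rewrite ler_pdivlMr// mul1r /row_const ler_sqrt//.
    exact: row_const_ge.
  apply: le_of_sqr; first by rewrite divr_ge0// sqrtr_ge0.
  rewrite !expr_div_n sy (sqr_sqrtr (ltW Np)) /row_const (sqr_sqrtr rc0).
  apply: le_trans (Rimx_mxnorm2_le hU hV nU nV y0 yt i N0) _.
  exact: row_const_sum.
have Qb : mxnorm (Qmx U V z i) <= row_const tau * (K / s).
  apply: le_trans (Qmx_le_frakKi _ _) _.
  have -> : row_const tau * (K / s) =
      K * ((Num.sqrt N%:R)^-1 * (row_const tau / Num.sqrt y)).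
    by rewrite sE; field; rewrite !lt0r_neq0.
  apply: ler_pM.
  - exact: le_trans (frakKi_ge1 _ _).
  - by rewrite mulr_ge0 ?invr_ge0 ?sqrtr_ge0// le_max ler01.
  - exact: frakKi_le_supK.
  - by rewrite ler_wpM2l ?invr_ge0 ?sqrtr_ge0.
apply: le_trans (mxnormD _ _) _; rewrite /error_const mulrDl; apply: lerD => //.
apply: le_trans (Phi_le _) _.
have -> : 54 * (bullet (opnorm (@Phi R)) * resolvent_bound tau) * (K / s) =
  phi1 * (54 * B * (K / s)) by rewrite /B /phi1; ring.
apply: ler_wpM2l; first exact: le_trans p1.
apply: le_trans dist _; apply: ler_wpM2l; first by rewrite mulr_ge0.
rewrite expr2 invfM ler_wpM2r ?invr_ge0 ?(ltW sp)//.
by apply: le_trans K1; rewrite invf_le1.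
Qed.

End OneMatrix.
End ErrorControl.

(** * Distance to the spectral edges and self-improvement *)

Section DistanceToEdges.
Context {R : realType}.
Implicit Types (z w : R[i]).

Lemma min_dist (a b a' b' d : R) : `|a - a'| <= d -> `|b - b'| <= d ->
  `|Num.min a b - Num.min a' b'| <= d.
Proof.
rewrite !ler_norml => /andP[h1 h2] /andP[h3 h4].
by rewrite !minEle; case: (leP a b) => ?; case: (leP a' b') => ?; apply/andP; split; lra.
Qed.

Lemma cabs_dist z w : `|cabs z - cabs w| <= cabs (z - w).
Proof.
have h (a b : R[i]) : cabs a <= cabs b + cabs (a - b).
  by have := cabsD b (a - b); rewrite addrC subrK.
have h1 := h z w; have h2 := h w z; rewrite (cabs_distC w z) in h2.
by rewrite ler_norml; apply/andP; split; lra.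
Qed.

Lemma hfun_dist z w : `|hfun z - hfun w| <= cabs (z - w).
Proof.
apply: min_dist; last by rewrite subrr normr0 cabs_ge0.
apply: min_dist; apply: le_trans (cabs_dist _ _) _.
  by rewrite opprD addrACA subrr addr0.
by rewrite opprB addrA subrK.
Qed.

Lemma Im_le_edge z (x : R) : 0 <= complex.Im z -> complex.Im z <= cabs (z + x%:C).
Proof.
move=> y0; apply: le_trans (Im_le_cabs _); rewrite cImD addr0; exact: ler_norm.
Qed.

Lemma hfun_gt0 z : 0 < complex.Im z -> 0 < hfun z.
Proof.
move=> y0; rewrite /hfun !lt_min ltr01 andbT; apply/andP; split.
  exact: lt_le_trans y0 (Im_le_edge _ (ltW y0)).
by rewrite -rmorphN; exact: lt_le_trans y0 (Im_le_edge _ (ltW y0)).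
Qed.

Lemma hfun_le1 z : hfun z <= 1. Proof. by rewrite /hfun ge_min lexx orbT. Qed.

Lemma hfun_top z : 1 <= complex.Im z -> hfun z = 1.
Proof.
move=> y1; apply/le_anti; rewrite hfun_le1 /hfun !le_min lexx andbT/=.
have y0 : 0 <= complex.Im z by exact: le_trans y1.
apply/andP; split; first exact: le_trans y1 (Im_le_edge _ y0).
by rewrite -rmorphN; exact: le_trans y1 (Im_le_edge _ y0).
Qed.

Lemma hfun_homo (x y y' : R) : 0 <= y -> y <= y' -> hfun (x +i* y) <= hfun (x +i* y').
Proof.
move=> y0 yy'.
have h (c : R) : cabs ((x +i* y) + c%:C) <= cabs ((x +i* y') + c%:C).
  apply: le_of_sqr; first exact: cabs_ge0.
  rewrite !sqr_cabs /= !addr0 lerD2l ler_pXn2r// nnegrE//; exact: le_trans yy'.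
rewrite /hfun !le_min !ge_min lexx !orbT andbT h/=.
by have := h (- zeta); rewrite rmorphN => ->; rewrite orbT.
Qed.

End DistanceToEdges.

Lemma stability_budget (R : realType) (s c k p : R) : 0 < s -> 1 <= c ->
  1 <= k -> 1 <= p -> s / c <= 1 / (8 * k * p) -> p * k <= c / s.
Proof.
move=> s0 c1 k1 p1; have c0 : 0 < c by exact: lt_le_trans c1.
have kp : 0 < 8 * k * p by rewrite !mulr_gt0//; exact: lt_le_trans ltr01 _.
rewrite ler_pdivlMr// ler_pdivlMr// mulrAC ler_pdivrMr// mul1r => h.
apply: le_trans h; have : 0 <= k * p * s by rewrite !mulr_ge0// ?ltW// (lt_le_trans ltr01).
lra.
Qed.

Section Bootstrap.
Context {R : realType} (mu : probability (measurableTypeR R) R) (cstar : R).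
Context (cubic : forall z : R[i], 0 < complex.Im z ->
  let m := stieltjes mu z in z * m ^+ 3 - m ^+ 2 - z * m - 1 = 0).
Context (cstar_ge1 : 1 <= cstar).
Context (cstarP : forall z : R[i], 0 < complex.Im z -> Num.sqrt (hfun z) / cstar
  <= 1 / (8 * bullet (opnorm (kappa mu z)) * bullet (opnorm (@Phi R)))).

Lemma kappaK z x : 0 < complex.Im z -> kappa mu z (stability_map (Mmx mu z) x) = x.
Proof.
move=> y0; have inj := stability_map_injective y0 (stieltjes_Im_ge0 mu y0) (cubic y0).
have E y : linfun (stability_map (Mmx mu z)) y = stability_map (Mmx mu z) y by rewrite lfunE.
have k0 : lker (linfun (stability_map (Mmx mu z))) == 0%VS.
  by apply/lker0P => a b; rewrite !E; exact: inj.
by rewrite -E; exact: lker0_lfunK.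
Qed.

Lemma kappa_le z x : mxnorm (kappa mu z x) <= bullet (opnorm (kappa mu z)) * mxnorm x.
Proof.
apply: le_trans (opnormP _ x) _; apply: ler_wpM2r; first exact: mxnorm_ge0.
exact: le_bullet.
Qed.

Section OneMatrix.
Context {N : nat} (U V : 'M[R[i]]_N) (N2 : (2 <= N)%N).
Context (hU : U^t* = U) (hV : V^t* = V) (nU : mxnorm U <= 4) (nV : mxnorm V <= 4).
Context (tau : R) (tau8 : 8 <= tau).
Implicit Types (z : R[i]) (i : 'I_N).

Let N0 : (0 < N)%N. Proof. exact: ltn_trans N2. Qed.
Let Np : 0 < N%:R :> R. Proof. by rewrite ltr0n. Qed.

Definition loss_const (t : R) : R :=
  3 * Mbound t * (Mbound t + 1) ^+ 2 * cstar * error_const t.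

(** The hypothesis on cstar turns the a priori bound into the smallness required
    by stability, and the stability constant into cstar / sqrt h. *)
Lemma self_improvement z : @calR R N tau z ->
  (forall i, mxnorm (Gmx U V z i - Mmx mu z) <= Num.sqrt (hfun z) / cstar) ->
  forall i, mxnorm (Gmx U V z i - Mmx mu z) <=
    loss_const tau * (supK U V tau / Num.sqrt (N%:R * hfun z * complex.Im z)).
Proof.
move=> hz hw i; have [y0 yt yN zb] := calR_bounds N2 hz.
have m0 := stieltjes_Im_ge0 mu y0; have cu := cubic y0.
have hp := hfun_gt0 y0; have hs : 0 < Num.sqrt (hfun z) by rewrite sqrtr_gt0.
have c0 : 0 < cstar by exact: lt_le_trans cstar_ge1.
set b := Mbound tau; set w := Num.sqrt (hfun z) / cstar.
have t0 : 0 <= tau by exact: le_trans (ler0n _ 8) tau8.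
have b0 : 0 <= b by rewrite /b /Mbound mulr_ge0// addr_ge0.
have Mb : mxnorm (Mmx mu z) <= b.
  apply: le_trans (mxnorm_M y0 m0 cu) _; rewrite /b /Mbound ler_wpM2l//.
  by rewrite [9 + tau](_ : _ = 1 + (8 + tau)) ?lerD2l//; ring.
set k := bullet (opnorm (kappa mu z)); set p := bullet (opnorm (@Phi R)).
have k1 : 1 <= k by exact: bullet_ge1.
have p1 : 1 <= p by exact: bullet_ge1.
have wkp : w <= 1 / (8 * k * p) by exact: cstarP.
have w1 : w <= 1.
  rewrite /w ler_pdivrMr// mul1r; apply: le_trans cstar_ge1.
  by rewrite -[leRHS]sqrtr1 ler_sqrt// hfun_le1.
have Fb : mxnorm (Gavg U V z) <= b + 1.
  apply: mxnorm_avg => // j.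
  have -> : Gmx U V z j = Mmx mu z + (Gmx U V z j - Mmx mu z) by rewrite addrC subrK.
  exact: le_trans (mxnormD _ _) (lerD Mb (le_trans (hw j) w1)).
set s := Num.sqrt (N%:R * complex.Im z).
set e := error_const tau * (supK U V tau / s).
have eb j := error_le N2 hU hV nU nV tau8 j hz Fb.
have := stability N0 (M_unit y0 m0 cu) (M_equation y0 m0 cu)
  (fun x => kappaK x y0) (kappa_le z) (Phi_le (R := R)) k1 p1 b0 Mb
  (self_consistency hU hV nU nV y0) hw wkp eb i.
move=> h; apply: le_trans h _; rewrite -/e.
have e0 : 0 <= e by apply: le_trans (mxnorm_ge0 _) (eb i).
have pk : p * k <= cstar / Num.sqrt (hfun z) by exact: stability_budget.
have sE : Num.sqrt (N%:R * hfun z * complex.Im z) = Num.sqrt (hfun z) * s.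
  by rewrite /s -sqrtrM ?ltW//; congr Num.sqrt; ring.
have -> : loss_const tau * (supK U V tau / Num.sqrt (N%:R * hfun z * complex.Im z)) =
   3 * b * (b + 1) ^+ 2 * (cstar / Num.sqrt (hfun z)) * e.
  rewrite sE invfM /loss_const /e -/b; ring.
rewrite ler_wpM2r// ler_wpM2l// mulr_ge0 ?sqr_ge0//.
by rewrite mulr_ge0.
Qed.

End OneMatrix.
End Bootstrap.

(** * Continuity *)

Section Continuity.
Context {R : realType}.

Lemma max_dist (a b a' b' d : R) : `|a - a'| <= d -> `|b - b'| <= d ->
  `|Num.max a b - Num.max a' b'| <= d.
Proof.
rewrite !ler_norml => /andP[h1 h2] /andP[h3 h4].
by rewrite !maxEle; case: (leP a b) => ?; case: (leP a' b') => ?; apply/andP; split; lra.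
Qed.

Lemma bigmax_dist (I : finType) (F G : I -> R) (d : R) : 0 <= d ->
  (forall i, `|F i - G i| <= d) ->
  `|\big[Num.max/0]_i F i - \big[Num.max/0]_i G i| <= d.
Proof.
move=> d0 h; elim/big_rec2: _ => [|i y1 y2 _ IH]; first by rewrite subrr normr0.
exact: max_dist.
Qed.

Lemma locally_lipschitz_continuous (f : R -> R) (y r L : R) : 0 < r ->
  (forall y', `|y' - y| < r -> `|f y' - f y| <= L * `|y' - y|) ->
  {for y, continuous f}.
Proof.
move=> r0 hf; apply/cvgrPdist_lt => e e0.
have L1 : 0 < `|L| + 1 by rewrite ltr_wpDl.
have d0 : 0 < Num.min r (e / (`|L| + 1)) by rewrite lt_min r0 divr_gt0.
have : \forall y' \near y, `|y - y'| < Num.min r (e / (`|L| + 1)).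
  by apply/nbhs_normP; exists (Num.min r (e / (`|L| + 1))).
apply: filterS => y'; rewrite distrC lt_min => /andP[yr ye].
rewrite distrC; apply: le_lt_trans (hf _ yr) _.
rewrite ltr_pdivlMr// in ye; apply: le_lt_trans ye; rewrite mulrC ler_wpM2l//.
by apply: le_trans (ler_norm L) _; rewrite lerDl.
Qed.

Lemma modulus_lipschitz_continuous (f : R[i] -> R) :
  (forall z w, `|f z - f w| <= cabs (z - w)) ->
  continuous (f : (R[i])^o -> R).
Proof.
move=> hf z A /nbhs_normP[e /= e0 eA].
change (nbhs (z : (R[i])^o) (f @^-1` A)).
apply/nbhs_ballP; exists (e%:C); first by rewrite /= ltcR.
move=> w; rewrite -ball_normE/= -cabs_norm ltcR => zw.
by apply: eA; exact: le_lt_trans (hf _ _) zw.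
Qed.

Lemma calX_closed N (U V : 'M[R[i]]_N) (cstar tau theta : R) : (0 < N)%N ->
  closed (calX U V cstar tau theta : set (R[i])^o).
Proof.
move=> N0; set c := 4 * cstar ^+ 2 * theta ^+ 2 * supK U V tau ^+ 2 / N%:R.
have cRe : continuous ((fun z => `|complex.Re z|) : (R[i])^o -> R).
  apply: modulus_lipschitz_continuous => z w; apply: le_trans (ler_dist_dist _ _) _.
  by rewrite -cReN -cReD; exact: Re_le_cabs.
have cIm : continuous ((@complex.Im R : R[i] -> R) : (R[i])^o -> R).
  apply: modulus_lipschitz_continuous => z w.
  by rewrite -cImN -cImD; exact: Im_le_cabs.
have ch : continuous ((@hfun R) : (R[i])^o -> R).
  exact: modulus_lipschitz_continuous (@hfun_dist R).
have pre (f : (R[i])^o -> R) (D : set R) : continuous f -> closed D -> closed (f @^-1` D).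
  by move=> /continuous_closedP cf; exact: cf.
have -> : (calX U V cstar tau theta : set (R[i])^o) =
   ((fun z : (R[i])^o => `|complex.Re z|) @^-1` [set x | x <= 8]) `&`
   (((fun z : (R[i])^o => complex.Im z) @^-1` [set x | N%:R^-1 <= x]) `&`
   (((fun z : (R[i])^o => complex.Im z) @^-1` [set x | x <= tau]) `&`
   ((fun z : (R[i])^o => hfun z * hfun z * complex.Im z) @^-1` [set x | c <= x]))).
  apply/seteqP; split => z /=.
    by case=> -[y0 x8 /andP[yN yt]]; rewrite expr2.
  move=> [x8 [yN [yt hc]]]; split; last by rewrite expr2.
  split=> //; last by rewrite yN.
  by rewrite /upper_half_plane/=; apply: lt_le_trans yN; rewrite invr_gt0 ltr0n.
apply: closedI.
  apply: pre; last exact: closed_le.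
  exact: cRe.
apply: closedI; first by apply: pre; [exact: cIm|exact: closed_ge].
apply: closedI; first by apply: pre; [exact: cIm|exact: closed_le].
apply: pre; last exact: closed_ge.
by move=> z; exact: (cvgM (cvgM (ch z) (ch z)) (cIm z)).
Qed.

Lemma Gmx_sub_le N (U V : 'M[R[i]]_N) (hU : U^t* = U) (hV : V^t* = V)
    (nU : mxnorm U <= 4) (nV : mxnorm V <= 4) (z z' : R[i]) (r T : R) (i : 'I_N) :
  0 < r -> r <= complex.Im z -> r <= complex.Im z' ->
  complex.Im z <= T -> complex.Im z' <= T ->
  mxnorm (Gmx U V z i - Gmx U V z' i) <= (resolvent_bound T / r) ^+ 2 * cabs (z - z').
Proof.
move=> r0 rz rz' zT zT'; have y0 := lt_le_trans r0 rz; have y0' := lt_le_trans r0 rz'.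
have T0 : 0 <= T by exact: le_trans (ltW y0) zT.
have RB w : 0 < complex.Im w -> r <= complex.Im w -> complex.Im w <= T ->
    mxnorm (Rmx U V w) <= resolvent_bound T / r.
  move=> w0 wr wT; apply: le_trans (Rmx_le hU hV nU nV w0 wT) _.
  by apply: ler_wpM2l; [exact: resolvent_bound_ge0|rewrite lef_pV2 ?posrE].
have -> : Gmx U V z i - Gmx U V z' i =
    bfe i *m (Rmx U V z - Rmx U V z') *m (bfe i)^t*.
  by rewrite /Gmx mulmxBr mulmxBl.
have h1 := mxnorm_bfe (R := R) i; have h1' := le_trans (mxnorm_adj _) h1.
apply: mxnormM_contr h1'; rewrite -[leRHS]mul1r; apply: mxnormM_le h1 _.
have u := denominator_unit hU hV nU nV y0; have u' := denominator_unit hU hV nU nV y0'.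
rewrite pencilE in u; rewrite pencilE in u'.
rewrite /Rmx !pencilE (resolvent_sub u u'); apply: le_trans (mxnormZ _ _) _.
rewrite mulrC; apply: ler_wpM2r; first exact: cabs_ge0.
rewrite expr2 -!pencilE; apply: mxnormM_le (RB _ y0' rz' zT').
apply: mxnormM_contr; first exact: RB.
exact: (mxnorm_proj projN_signN projN_idem projN_adj signN_adj).
Qed.

End Continuity.

(** * Descent along vertical lines *)

Section Descent.
Context {R : realType} (mu : probability (measurableTypeR R) R) (cstar : R).
Context (cubic : forall z : R[i], 0 < complex.Im z ->
  let m := stieltjes mu z in z * m ^+ 3 - m ^+ 2 - z * m - 1 = 0).
Context (cstar_ge1 : 1 <= cstar).
Context (cstarP : forall z : R[i], 0 < complex.Im z -> Num.sqrt (hfun z) / cstar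
  <= 1 / (8 * bullet (opnorm (kappa mu z)) * bullet (opnorm (@Phi R)))).

Lemma Mmx_sub_le (z z' : R[i]) (r T : R) : 0 < r -> r <= complex.Im z ->
  r <= complex.Im z' -> cabs z <= T -> cabs z' <= T ->
  mxnorm (Mmx mu z - Mmx mu z') <=
  (1 + 2 * (1 + T) ^+ 2) * (2 / r ^+ 2) * cabs (z - z').
Proof.
move=> r0 rz rz' zT zT'; have y0 := lt_le_trans r0 rz; have y0' := lt_le_trans r0 rz'.
have T0 : 0 <= T by exact: le_trans (cabs_ge0 z) zT.
have inv_le (w p : R[i]) : cabs w <= T -> (1 + cabs w)^-1 <= cabs p -> cabs p^-1 <= 1 + T.
  move=> wT h; have w1 : 0 < 1 + cabs w by rewrite ltr_pwDl// cabs_ge0.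
  rewrite cabsV -[leRHS]invrK lef_pV2 ?posrE ?invr_gt0 ?ltr_pwDl//.
    by apply: le_trans h; rewrite lef_pV2 ?posrE ?ltr_pwDl// lerD2l.
  by apply: lt_le_trans h; rewrite invr_gt0.
have m0 := stieltjes_Im_ge0 mu y0; have m0' := stieltjes_Im_ge0 mu y0'.
have c := cubic y0; have c' := cubic y0'.
have [_ n1 n2] := cubic_neq0 y0 m0 c; have [_ n1' n2'] := cubic_neq0 y0' m0' c'.
have T1 : 0 <= 1 + T by rewrite addr_ge0.
apply: le_trans (diag3_sub_le T1 n1 n2 n1' n2' (inv_le _ _ zT (cubic_sub1 y0 m0 c))
  (inv_le _ _ zT (cubic_add1 y0 m0 c)) (inv_le _ _ zT' (cubic_sub1 y0' m0' c'))
  (inv_le _ _ zT' (cubic_add1 y0' m0' c'))) _.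
rewrite -mulrA; apply: ler_wpM2l; first by rewrite addr_ge0// mulr_ge0// sqr_ge0.
apply: le_trans (stieltjes_lipschitz mu y0 y0') _.
rewrite -mulrA ler_wpM2l// mulrC ler_wpM2r ?cabs_ge0//.
rewrite lef_pV2 ?posrE ?exprn_gt0 ?mulr_gt0// expr2.
by apply: ler_pM => //; exact: ltW.
Qed.

(** 33 (33 + s) / s^2 + 18 / s^2 is at most (33 * 34 + 18) / s for s at least 1. *)
Definition top_const : R := 1140.

Lemma top_const_gt0 : 0 < top_const.
Proof. by rewrite /top_const ltr0n. Qed.

Lemma top_arith (t s : R) : 1 <= s -> t = s ^+ 2 ->
  33 * ((1 + 32 + s) / t) + 18 / t <= top_const / s.
Proof.
move=> s1 ->; have s0 : 0 < s by exact: lt_le_trans s1.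
rewrite mulrA -mulrDl ler_pdivrMr ?exprn_gt0// expr2 mulrA divfK ?gt_eqF//.
by rewrite /top_const; lra.
Qed.

Section OneMatrix.
Context {N : nat} (U V : 'M[R[i]]_N) (N2 : (2 <= N)%N).
Context (hU : U^t* = U) (hV : V^t* = V) (nU : mxnorm U <= 4) (nV : mxnorm V <= 4).
Implicit Types (z : R[i]) (i : 'I_N).

Let N0 : (0 < N)%N. Proof. exact: ltn_trans N2. Qed.
Let Np : 0 < N%:R :> R. Proof. by rewrite ltr0n. Qed.

(** Far from the real axis both G_i and M are close to diag (0, 1, -1). *)
Lemma Gmx_top z i : 8 <= complex.Im z ->
  mxnorm (Gmx U V z i - Mmx mu z) <= top_const / Num.sqrt (complex.Im z).
Proof.
move=> y8; set y := complex.Im z.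
have y0 : 0 < y by exact: lt_le_trans y8.
have s1 : 1 <= Num.sqrt y.
  by rewrite -[leLHS]sqrtr1 ler_sqrt ?(ltW y0)//; apply: le_trans y8; rewrite ler1n.
have GJ : mxnorm (Gmx U V z i - signE) <= 33 * ((1 + 32 + Num.sqrt y) / y).
  have -> : Gmx U V z i - signE = bfe i *m (Rmx U V z - signN) *m (bfe i)^t*.
    rewrite mulmxBr mulmxBl; congr (_ - _).
    by rewrite bfe_tens1; exact/esym/tens_mx11.
  have h1 := mxnorm_bfe (R := R) i; have h1' := le_trans (mxnorm_adj _) h1.
  apply: mxnormM_contr h1'; rewrite -[leRHS]mul1r; apply: mxnormM_le h1 _.
  have := Rmx_sub_sign_le hU hV nU nV y0 (lexx _); rewrite /resolvent_const.
  by rewrite -(natrD R 1 32).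
have m2 : cabs (stieltjes mu z) <= 2 / y by exact: stieltjes_le.
have m1 : cabs (stieltjes mu z) <= 2^-1.
  apply: le_trans m2 _; rewrite ler_pdivrMr// mulrC ler_pdivlMr// -natrM.
  by apply: le_trans y8; rewrite ler_nat.
have half (a : R[i]) : 2^-1 <= cabs a -> cabs a^-1 <= 2.
  move=> h; rewrite cabsV -[leRHS]invrK lef_pV2 ?posrE ?invr_gt0//.
  by apply: lt_le_trans h; rewrite invr_gt0.
have [_ n1 n2] := cubic_neq0 y0 (stieltjes_Im_ge0 mu y0) (cubic y0).
have JM : mxnorm (signE - Mmx mu z) <= 18 / y.
  have -> : signE = diag3 0 (- (0 - 1)^-1) (- (0 + 1)^-1) :> 'M[R[i]]_3.
    by rewrite /signE sub0r add0r invrN opprK invr1.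
  have c1 : cabs (1 : R[i]) = 1 by exact: cabs1.
  have b1 : 2^-1 <= cabs (stieltjes mu z - 1).
    have := cabsB (stieltjes mu z) (stieltjes mu z - 1).
    rewrite opprB addrC subrK c1 => h.
    move: m1 h; move: (cabs (stieltjes mu z)) (cabs _) => p q; lra.
  have b2 : 2^-1 <= cabs (stieltjes mu z + 1).
    have := cabsB (stieltjes mu z + 1) (stieltjes mu z).
    rewrite addrAC subrr add0r c1 => h.
    move: m1 h; move: (cabs (stieltjes mu z)) (cabs _) => p q; lra.
  have h0 : 2^-1 <= cabs (0 - 1 : R[i]).
    by rewrite sub0r cabsN c1 invf_le1// ler1n.
  have h0' : 2^-1 <= cabs (0 + 1 : R[i]) by rewrite add0r c1 invf_le1// ler1n.
  apply: le_trans (diag3_sub_le (ler0n _ 2) _ _ n1 n2 (half _ h0) (half _ h0')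
    (half _ b1) (half _ b2)) _.
  - by rewrite sub0r oppr_eq0 oner_eq0.
  - by rewrite add0r oner_eq0.
  rewrite sub0r cabsN; have -> : 18 / y = 9 * (2 / y) by ring.
  by apply: ler_pM => //; lra.
have -> : Gmx U V z i - Mmx mu z = (Gmx U V z i - signE) + (signE - Mmx mu z).
  by rewrite addrA subrK.
apply: le_trans (mxnormD _ _) _; apply: le_trans (lerD GJ JM) _.
by apply: top_arith => //; rewrite sqr_sqrtr// ltW.
Qed.

Definition deviation (x y : R) : R :=
  \big[Num.max/0]_(i < N) mxnorm (Gmx U V (x +i* y) i - Mmx mu (x +i* y)).

Lemma deviation_continuous (x y : R) : 0 < y -> {for y, continuous (deviation x)}.
Proof.
move=> y0; set r := y / 2; set T := `|x| + (y + r).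
have r0 : 0 < r by rewrite divr_gt0.
set L := (resolvent_bound (y + r) / r) ^+ 2 + (1 + 2 * (1 + T) ^+ 2) * (2 / r ^+ 2).
apply: (@locally_lipschitz_continuous _ _ y r L r0) => y' yy'.
have yE : y = r + r by rewrite /r -splitr.
have [ry' y'T] : r <= y' /\ y' <= y + r.
  by move: yy'; rewrite ltr_norml => /andP[h1 h2]; split; lra.
have ry : r <= y by rewrite yE lerDl ltW.
have yT : y <= y + r by rewrite lerDl ltW.
have cT t : r <= t -> t <= y + r -> cabs (x +i* t) <= T.
  move=> rt tT; apply: le_trans (cabs_le_ReIm _) _; rewrite /= lerD2l ger0_norm//.
  exact: le_trans (ltW r0) rt.
have d : cabs ((x +i* y') - (x +i* y)) = `|y' - y|.
  by rewrite cabsE /= subrr expr0n add0r sqrtr_sqr.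
have L0 : 0 <= L.
  rewrite /L addr_ge0 ?sqr_ge0//; apply: mulr_ge0.
    by rewrite addr_ge0// mulr_ge0// sqr_ge0.
  by rewrite divr_ge0// sqr_ge0.
apply: bigmax_dist => [|i]; first by rewrite mulr_ge0.
have tri (A B : 'M[R[i]]_3) : `|mxnorm A - mxnorm B| <= mxnorm (A - B).
  have h (P Q : 'M[R[i]]_3) : mxnorm P <= mxnorm Q + mxnorm (P - Q).
    by have := mxnormD Q (P - Q); rewrite addrC subrK.
  have h1 := h A B; have := h B A.
  rewrite -[mxnorm (B - A)]mxnormN opprB => h2.
  rewrite ler_norml; move: h1 h2; move: (mxnorm A) (mxnorm B) (mxnorm _) => p q s h1 h2.
  by apply/andP; split; lra.
apply: le_trans (tri _ _) _.
have -> : Gmx U V (x +i* y') i - Mmx mu (x +i* y') -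
          (Gmx U V (x +i* y) i - Mmx mu (x +i* y)) =
   (Gmx U V (x +i* y') i - Gmx U V (x +i* y) i) -
   (Mmx mu (x +i* y') - Mmx mu (x +i* y)).
  move: (Gmx U V _ i) (Gmx U V _ i) (Mmx mu _) (Mmx mu _) => a b c e.
  by rewrite !opprB addrACA [in RHS]addrACA; congr (_ + _); rewrite addrC.
apply: le_trans (mxnormB _ _) _; rewrite /L mulrDl -d; apply: lerD.
  exact: (Gmx_sub_le hU hV nU nV i r0).
by apply: Mmx_sub_le => //; exact: cT.
Qed.

Context (tau theta : R) (tau8 : 8 <= tau) (tau_top : (top_const * cstar) ^+ 2 <= tau).
Context (theta1 : 1 <= theta) (theta_loss : loss_const cstar tau <= theta).

Let c0 : 0 < cstar. Proof. exact: lt_le_trans cstar_ge1. Qed.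

(** Both h and Im z increase upwards along a vertical line. *)
Lemma calX_up (x y y' : R) : calX U V cstar tau theta (x +i* y) -> y <= y' -> y' <= tau ->
  calX U V cstar tau theta (x +i* y').
Proof.
move=> [[y0 x8 /andP[yN yt]] hy] yy' yt'; rewrite /upper_half_plane/= in y0 x8 yN yt hy.
have y0' : 0 < y' by exact: lt_le_trans yy'.
split.
  by split=> //=; rewrite yt' andbT; exact: le_trans yN yy'.
apply: le_trans hy _; apply: ler_pM => //=.
- by rewrite sqr_ge0.
- exact: ltW.
- have hh := hfun_homo x (ltW y0) yy'.
  rewrite ler_pXn2r// nnegrE; first by apply/ltW/hfun_gt0.
  by apply/ltW/hfun_gt0.
Qed.

(** The inequality defining calX, after taking square roots. *)
Lemma calX_scale z : calX U V cstar tau theta z ->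
  theta * supK U V tau / Num.sqrt (N%:R * hfun z * complex.Im z) <=
  Num.sqrt (hfun z) / cstar / 2.
Proof.
move=> [[y0 _ _] hX]; rewrite /upper_half_plane/= in y0.
have h0 := hfun_gt0 y0; set h := hfun z in h0 hX *; set y := complex.Im z in y0 hX *.
set K := supK U V tau in hX *.
have q0 : 0 < N%:R * h * y by rewrite !mulr_gt0.
apply: le_of_sqr; first by rewrite !divr_ge0 ?sqrtr_ge0 ?(ltW c0).
rewrite !expr_div_n (sqr_sqrtr (ltW q0)) (sqr_sqrtr (ltW h0)).
rewrite ler_pdivrMr// exprMn.
have -> : h / cstar ^+ 2 / 2 ^+ 2 * (N%:R * h * y) =
  (h ^+ 2 * y * N%:R) / (4 * cstar ^+ 2).
  by field; rewrite lt0r_neq0.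
rewrite ler_pdivlMr ?mulr_gt0 ?exprn_gt0// -ler_pdivrMr//.
by apply: le_trans hX; rewrite le_eqVlt; apply/orP; left; apply/eqP; congr (_ / _); ring.
Qed.

Lemma improved_half (x y : R) : calX U V cstar tau theta (x +i* y) ->
  deviation x y <= Num.sqrt (hfun (x +i* y)) / cstar ->
  deviation x y <= theta * supK U V tau /
    Num.sqrt (N%:R * hfun (x +i* y) * complex.Im (x +i* y)).
Proof.
move=> hX hd; have [hR _] := hX.
have K0 : 0 <= supK U V tau by exact: le_trans (supK_ge1 N2 hU hV nU nV tau8).
have dev i : mxnorm (Gmx U V (x +i* y) i - Mmx mu (x +i* y)) <=
    Num.sqrt (hfun (x +i* y)) / cstar.
  by apply: le_trans hd; exact: (le_bigmax _ _ i).
have := self_improvement cubic cstar_ge1 cstarP N2 hU hV nU nV tau8 hR dev.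
move=> imp; have b0 : 0 <= supK U V tau /
    Num.sqrt (N%:R * hfun (x +i* y) * complex.Im (x +i* y)).
  by rewrite divr_ge0 ?sqrtr_ge0.
apply: bigmax_le => [|i _].
  by rewrite -mulrA mulr_ge0// (le_trans _ theta1).
apply: le_trans (imp i) _; rewrite -[leRHS]mulrA; exact: ler_wpM2r.
Qed.

(** A deviation at most b is at most b / 2, so it never takes a value in
    (b / 2, b]. It is at most b at height tau, hence, by the intermediate value
    theorem, all the way down the vertical segment inside calX. *)
Lemma descent (x y : R) : calX U V cstar tau theta (x +i* y) ->
  deviation x y <= Num.sqrt (hfun (x +i* y)) / cstar.
Proof.
move=> hX; have [[y0 _ /andP[_ yt]] _] := hX; rewrite /upper_half_plane/= in y0 yt.
pose b t := Num.sqrt (hfun (x +i* t)) / cstar.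
have b_gt0 t : 0 < t -> 0 < b t.
  by move=> t0; rewrite divr_gt0// sqrtr_gt0; exact: hfun_gt0.
have half t : y <= t -> t <= tau -> deviation x t <= b t -> deviation x t <= b t / 2.
  move=> yt' tt hd; have hXt := calX_up hX yt' tt.
  exact: le_trans (improved_half hXt hd) (calX_scale hXt).
(* Any factor strictly between 1/2 and 1 would do. *)
pose f t := deviation x t - 3 / 4 * b t.
have top : deviation x tau <= b tau.
  have t0 : 0 <= tau by exact: le_trans (ler0n _ 8) tau8.
  have hb : b tau = cstar^-1.
    by rewrite /b hfun_top ?sqrtr1 ?mul1r//=; apply: le_trans tau8; rewrite ler1n.
  apply: (@le_trans _ _ cstar^-1); last by rewrite hb.
  apply: bigmax_le => [|i _]; first by rewrite invr_ge0 ltW.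
  apply: le_trans (Gmx_top (z := x +i* tau) i tau8) _.
  change (top_const / Num.sqrt tau <= cstar^-1).
  have st : top_const * cstar <= Num.sqrt tau.
    by apply: le_of_sqr; [exact: sqrtr_ge0|rewrite sqr_sqrtr].
  have st0 : 0 < Num.sqrt tau by apply: lt_le_trans st; exact: mulr_gt0 top_const_gt0 c0.
  by rewrite ler_pdivrMr// mulrC ler_pdivlMr.
have cf : {within `[y, tau], continuous f}.
  apply: continuous_in_subspaceT => t; rewrite inE /= in_itv/= => /andP[yt' _].
  have t0 : 0 < t by exact: lt_le_trans yt'.
  have cb : {for t, continuous b}.
    have ch : {for t, continuous (fun s => hfun (x +i* s))}.
      apply: (@locally_lipschitz_continuous _ _ t 1 1) => // s _.
      apply: le_trans (hfun_dist _ _) _; rewrite mul1r.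
      by rewrite cabsE /= subrr expr0n add0r sqrtr_sqr.
    apply: (@continuousM _ _ (fun s => Num.sqrt (hfun (x +i* s))) (fun=> cstar^-1)).
      apply: continuous_comp ch _; exact: sqrt_continuous.
    exact: cvg_cst.
  apply: continuousB; first exact: deviation_continuous.
  by apply: continuousM cb; exact: cvg_cst.
have ftau : f tau <= 0.
  have := half tau yt (lexx _) top; have := b_gt0 tau (lt_le_trans y0 yt).
  by rewrite /f; move: (b tau) (deviation x tau) => p q; lra.
have [fy|fy] := leP (f y) 0.
  have := b_gt0 y y0; move: fy; rewrite /f -/(b y); move: (b y) (deviation x y) => p q; lra.
have [t] : exists2 t, t \in `[y, tau] & f t = 0.
  apply: IVT => //; rewrite ge_min ftau orbT le_max (ltW fy) //.
rewrite in_itv/= => /andP[yt' tt] ft; exfalso.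
have bt := b_gt0 t (lt_le_trans y0 yt').
have hf := half t yt' tt.
move: ft hf bt; rewrite /f; move: (b t) (deviation x t) => p q ft hf bt.
have qp : q <= p by lra.
have := hf qp; lra.
Qed.

End OneMatrix.
End Descent.

Theorem theorem7p9 (R : realType) (A : algType R[i]) (phi : {scalar A})
    (u v : A) (mu : probability (measurableTypeR R) R) (cstar : R)
    (phi1 : phi 1 = 1)
    (semicircular_u : standard_semicircular phi u)
    (semicircular_v : standard_semicircular phi v)
    (free_uv : freely_independent phi u v)
    (law_mu : is_law phi (u * v + v * u) mu)
    (Nica_Speicher : forall z : R[i], upper_half_plane z ->
      let m := stieltjes mu z in z * m ^+ 3 - m ^+ 2 - z * m - 1 = 0)
    (cstar_ge1 : 1 <= cstar)
    (cstarP : forall z : R[i], upper_half_plane z ->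
      Num.sqrt (hfun z) / cstar
        <= 1 / (8 * bullet (opnorm (kappa mu z)) * bullet (opnorm (@Phi R)))) :
  exists2 tau0 : R, 8 <= tau0 &
  forall tau : R, tau0 <= tau ->
  exists2 theta0 : R, 1 <= theta0 &
  forall theta : R, theta0 <= theta ->
  forall (N : nat) (U V : 'M[R[i]]_N),
    (2 <= N)%N -> U \is hermsymmx -> V \is hermsymmx ->
    Num.max (mxnorm U) (mxnorm V) <= 4 ->
    [/\ has_sup [set frakK U V z | z in @calR R N tau],
        closed (calX U V cstar tau theta : set (R[i])^o)
      & forall z : R[i], calX U V cstar tau theta z ->
          \big[Num.max/0]_(i < N) mxnorm (Gmx U V z i - Mmx mu z)
            <= theta * supK U V tau / Num.sqrt (N%:R * hfun z * complex.Im z)].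
Proof.
exists (Num.max 8 ((top_const * cstar) ^+ 2)); first by rewrite le_max lexx.
move=> tau; rewrite ge_max => /andP[tau8 tau_top].
exists (Num.max 1 (loss_const cstar tau)); first by rewrite le_max lexx.
move=> theta; rewrite ge_max => /andP[theta1 theta_loss] N U V N2 hermU hermV.
rewrite ge_max => /andP[nU nV].
have adj (W : 'M[R[i]]_N) : W \is hermsymmx -> W^t* = W.
  by move=> /is_hermitianmxP e; rewrite [RHS]e expr0 scale1r.
have hU := adj U hermU; have hV := adj V hermV.
split.
- exact: (frakK_has_sup N2 hU hV nU nV tau8).
- by apply: calX_closed; exact: ltn_trans N2.
- case=> x y hX.
  have hd := descent Nica_Speicher cstar_ge1 cstarP N2 hU hV nU nV tau8 tau_top
    theta1 theta_loss hX.
  exact: (improved_half Nica_Speicher cstar_ge1 cstarP N2 hU hV nU nV tau8 theta1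
    theta_loss hX hd).
Qed.
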